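(* Let $G$ be a finitely generated virtually nilpotent group. Then $G$ has multiple context-free word problem if and only if $G$ is virtually abelian.
   Context: Word problem: a choice of generators for a group $G$ is a surjective monoid homomorphism $\pi:\Sigma^*\to G$, where $\Sigma$ is a finite nonempty alphabet equipped with a fixed-point-free involution $a\mapsto a^{-1}$ satisfying $\pi(a^{-1})=\pi(a)^{-1}$ for all $a\in\Sigma$, and $\Sigma^*$ is the free monoid on $\Sigma$. The word problem of $G$ is the language $\operatorname{WP}(G)=\pi^{-1}(1)\subset\Sigma^*$. Whether it is multiple context-free does not depend on the choice of generators. Multiple context-free (MCF) languages: a multiple context-free grammar over a finite alphabet $\Sigma$ consists of a finite set $N$ of nonterminals, each $A\in N$ having a dimension $d(A)\ge 1$; a start symbol $S\in N$ with $d(S)=1$; and a finite set of rules $A\to f[A_1,\dots,A_k]$ with $k\ge 0$, $A,A_1,\dots,A_k\in N$, where $f:(\Sigma^* )^{d(A_1)}\times\cdots\times(\Sigma^* )^{d(A_k)}\to(\Sigma^* )^{d(A)}$ is a function each of whose $d(A)$ components is a fixed concatenation of letters of $\Sigma$ and variables $x_{ij}$ ($1\le i\le k$, $1\le j\le d(A_i)$; $x_{ij}$ stands for the $j$-th entry of the $i$-th argument), such that each variable $x_{ij}$ occurs at most once in total across all components of $f$. The sets $L(A)\subset(\Sigma^* )^{d(A)}$, $A\in N$, are the smallest sets such that for every rule $A\to f[A_1,\dots,A_k]$ and all $t_i\in L(A_i)$ one has $f(t_1,\dots,t_k)\in L(A)$. The language generated is $L(S)\subset\Sigma^*$. A language is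 multiple context-free if it is generated by some multiple context-free grammar. *)

(* Defs.v *)
From HB Require Import structures.
From mathcomp Require Import all_boot.
From mathcomp Require Import boolp classical_sets cardinality.

Set Implicit Arguments.
Unset Strict Implicit.
Unset Printing Implicit Defensive.

Local Open Scope classical_set_scope.
Local Open Scope group_scope.

(** * Groups

    A [groupType] may be infinite.  Its [choiceType] structure is no restriction
    in classical logic, where every type carries one.  Subgroups are [Prop]-valued
    sets, so that no decidability is imposed on them. *)

Record is_subgroup (G : groupType) (H : set G) : Prop := IsSubgroup {
  subgroup1 : H 1;
  subgroupM : forall x y, H x -> H y -> H (x * y);
  subgroupV : forall x, H x -> H x^-1 }.

Definition generated (G : groupType) (A : set G) : set G :=
  smallest (@is_subgroup G) A.

Definition finitely_generated (G : groupType) : Prop :=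
  exists2 A : set G, finite_set A & generated A = [set: G].

Definition left_coset (G : groupType) (H : set G) (x : G) : set G :=
  [set x * h | h in H].

Definition finite_index (G : groupType) (H : set G) : Prop :=
  finite_set (range (left_coset H)).

Fixpoint lower_central (G : groupType) (H : set G) (n : nat) : set G :=
  if n is m.+1 then
    generated [set [~ x, y] | x in lower_central H m & y in H]
  else H.

Definition nilpotent_subgroup (G : groupType) (H : set G) : Prop :=
  exists n, lower_central H n = [set 1].

Definition abelian_subgroup (G : groupType) (H : set G) : Prop :=
  forall x y, H x -> H y -> commute x y.

Definition virtually (P : forall G : groupType, set G -> Prop)
    (G : groupType) : Prop :=
  exists H : set G, [/\ is_subgroup H, finite_index H & P G H].

Definition virtually_nilpotent : groupType -> Prop :=
  virtually nilpotent_subgroup.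

Definition virtually_abelian : groupType -> Prop :=
  virtually abelian_subgroup.

(** * Word problems *)

Record is_choice_of_generators (G : groupType) (Sigma : finType)
    (inv : Sigma -> Sigma) (pi : seq Sigma -> G) : Prop :=
  IsChoiceOfGenerators {
    alphabet_nonempty : inhabited Sigma;
    inv_involutive : involutive inv;
    inv_fixed_point_free : forall a, inv a <> a;
    pi_nil : pi [::] = 1;
    pi_cat : forall u v, pi (u ++ v) = pi u * pi v;
    pi_inv : forall a, pi [:: inv a] = (pi [:: a])^-1;
    pi_surjective : forall g, exists w, pi w = g }.

Definition word_problem (G : groupType) (Sigma : finType)
    (pi : seq Sigma -> G) : set (seq Sigma) :=
  [set w | pi w = 1].

(** * Multiple context-free languages

    The finite set of rules is presented as a family indexed by the finite type
    [rule].  A variable x_ij of the rule [r] is the dependent pair of [i] and [j];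
    the [l]-th component of the function of [r] is [rule_body r l], a word over
    letters ([inl]) and variables ([inr]). *)

Record mcfg (Sigma : finType) : Type := MCFG {
  nonterminal : finType;
  dim : nonterminal -> nat;
  dim_gt0 : forall A, 0 < dim A;
  start : nonterminal;
  dim_start : dim start = 1%N;
  rule : finType;
  rule_lhs : rule -> nonterminal;
  rule_arity : rule -> nat;
  rule_rhs : forall r, 'I_(rule_arity r) -> nonterminal;
  rule_body : forall r, 'I_(dim (rule_lhs r)) ->
    seq (Sigma + {i : 'I_(rule_arity r) & 'I_(dim (rule_rhs i))});
  rule_linear : forall r (x : {i : 'I_(rule_arity r) & 'I_(dim (rule_rhs i))}),
    (\sum_(l < dim (rule_lhs r)) count_mem (inr x) (rule_body l) <= 1)%N }.

Section Language.
Variables (Sigma : finType) (g : mcfg Sigma).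

Definition wtuple (A : nonterminal g) := (dim A).-tuple (seq Sigma).

Definition rule_args (r : rule g) :=
  forall i : 'I_(rule_arity r), wtuple (rule_rhs i).

Definition symbol_value (r : rule g) (t : rule_args r)
    (s : Sigma + {i : 'I_(rule_arity r) & 'I_(dim (rule_rhs i))}) : seq Sigma :=
  match s with
  | inl a => [:: a]
  | inr (existT i j) => tnth (t i) j
  end.

Definition rule_fun (r : rule g) (t : rule_args r) : wtuple (rule_lhs r) :=
  [tuple flatten [seq symbol_value t s | s <- rule_body l]
    | l < dim (rule_lhs r)].

Inductive derives : forall A : nonterminal g, wtuple A -> Prop :=
| Derives (r : rule g) (t : rule_args r) :
    (forall i, derives (t i)) -> derives (rule_fun t).

(* [dim (start g)] equals 1 only propositionally, hence the comparison of
   underlying sequences *)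
Definition language : set (seq Sigma) :=
  [set w | exists2 t : wtuple (start g), derives t & tval t = [:: w]].

End Language.

Definition multiple_context_free (Sigma : finType) (L : set (seq Sigma)) : Prop :=
  exists g : mcfg Sigma, language g = L.

(* Main.v *)
Require Import Defs.
From HB Require Import structures.
From mathcomp Require Import all_boot all_order all_algebra zify.
From mathcomp Require Import boolp classical_sets cardinality.
(* From here on [dim] is the dimension of a nonterminal, not that of a vector space. *)
Import Defs.

(** Let [H] be an abelian subgroup of finite index in [G]. A word over the
    generators acts on the finitely many cosets of [H], and each of its letters
    contributes an element of [H] that depends on the coset it meets; the word
    is trivial in [G] exactly when it fixes the coset [H] and its contributions
    add up to zero ([virtually_abelian_mcf]). Languages defined by a finite
    automaton with such an additive counter are multiple context-free
    ([counter_mcf]). The grammar generates [k]-tuples of words, for a fixed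
    large [k]; a nonterminal prescribes the states of the automaton around each
    component and the value of the counter, among finitely many values. The
    point is that every long tuple arises from two shorter ones of the same
    kind by cutting and regrouping ([split_tuple]). By the necklace splitting
    theorem, in a form with bounded error ([necklace_splitting]), a bounded
    number of cuts divides the tuple into two parts that contain about half of
    the occurrences of each edge of the automaton and about half of the
    components. Two such parts again consist of at most [k] words each. Their
    counters remain in the same finite set because half of a relation between
    the labels is close to a relation ([lattice_halving]). Necklace splitting
    rests on a discrete Borsuk-Ulam theorem ([hemisphere_sum]), proved with
    cup products modulo 2 on a grid of cubes.

    Conversely, suppose that the word problem is multiple context-free. Pumping
    in derivation trees, as in Parikh's theorem, shows that in a language of
    words x_0^(n_0) ... x_r^(n_r) cut out by a multiple context-free language
    every large vector of exponents can be increased by a bounded nonzero vector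
    ([mcf_block_pumping]). If a commutator z of x and y commuted with x and y
    and had infinite order, the trivial words among the products
    x^-p y^-q x^p' y^q' z^-r would be those with p' = p, q' = q and r = p q,
    and multiplication does not allow bounded increments when p and q are
    large. Hence such commutators are torsion ([mcf_commutator_torsion]). In a
    finitely generated nilpotent group this makes all quotients of the upper
    central series above the centre torsion, hence finite, and the centre has
    finite index ([virtually_abelian_of_nilpotent]). *)

Set Implicit Arguments.
Unset Strict Implicit.
Unset Printing Implicit Defensive.
Import Order.TTheory GRing.Theory Num.Theory.

Local Notation "\xor_ ( i < n ) F" := (\big[addb/false]_(i < n) F)
  (at level 41, F at level 41, i, n at level 50).

(** * Cochains modulo 2 on the cubical grid *)

Section Cubical.
Local Open Scope ring_scope.
Implicit Types (g : seq int -> bool) (ys zs : seq int).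

(** The coboundary of the cochain [g], modulo 2. A list of integers is the centre
    of a cell of the grid of cubes of side 2: its odd coordinates are the free
    directions of the cell, and a face of codimension one is obtained by moving
    one odd coordinate to one of its two even neighbours. *)
Fixpoint facets g ys : bool :=
  if ys is y :: ys' then
    (odd `|y|%N && (g (y - 1 :: ys') (+) g (y + 1 :: ys')))
    (+) facets (fun zs => g (y :: zs)) ys'
  else false.

Definition face zs ys :=
  all2 (fun z y : int => (z == y) || odd `|y|%N && ((z == y - 1) || (z == y + 1))) zs ys.

Lemma face_refl ys : face ys ys.
Proof. by rewrite /face; elim: ys => //= y ys ->; rewrite eqxx. Qed.

Lemma facets_congr g g' ys : (forall zs, face zs ys -> g zs = g' zs) ->
  facets g ys = facets g' ys.
Proof.
elim: ys g g' => //= y ys IH g g' E; congr addb; last first.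
  by apply: IH => zs F; apply: E; rewrite /= eqxx F.
case o: (odd _) => //=.
by rewrite !E //= o !eqxx ?orbT -/(face _ _) face_refl.
Qed.

Lemma facetsD g g' ys : facets (fun z => g z (+) g' z) ys = facets g ys (+) facets g' ys.
Proof.
elim: ys g g' => //= y ys IH g g'; rewrite IH.
by rewrite [RHS]addbACA -andb_addr; congr ((_ && _) (+) _); rewrite addbACA.
Qed.

Lemma facets_andr g b ys : facets (fun z => g z && b) ys = facets g ys && b.
Proof.
case: b; first by rewrite andbT; apply: facets_congr => z _; rewrite andbT.
rewrite andbF; elim: ys g => //= y ys IH g; by rewrite IH !andbF.
Qed.

Lemma facets_true ys : facets xpredT ys = false.
Proof. by elim: ys => //= y ys ->; rewrite andbF. Qed.

(** A face of codimension two is reached by moving two distinct odd coordinates,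
    in either order, so that every contribution occurs twice. *)
Lemma facetsK g ys : facets (facets g) ys = false.
Proof.
elim: ys g => //= y ys IH g; case o: (odd _) => /=; last first.
  by rewrite -[RHS](IH (fun zs => g (y :: zs))); apply: facets_congr => z _; rewrite ?o.
have o1 : odd `|(y - 1)%R|%N = false by lia.
have o2 : odd `|(y + 1)%R|%N = false by lia.
by rewrite o1 o2 /= !facetsD IH addbF addbb.
Qed.

Lemma facets_exists g ys : facets g ys -> exists2 zs, face zs ys & g zs.
Proof.
move=> h; apply: contrapT => nex.
have e : facets g ys = facets (fun z => g z && false) ys.
  by apply: facets_congr => z zf; rewrite andbF; apply/negP => gz; apply: nex; exists z.
by move: h; rewrite e facets_andr andbF.
Qed.

Definition opps ys : seq int := [seq - y | y <- ys].

Lemma facets_opps g ys : facets g (opps ys) = facets (fun zs => g (opps zs)) ys.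
Proof.
elim: ys g => //= y ys IH g; rewrite IH abszN opprB opprD.
by congr (_ && _ (+) _); rewrite addbC [- y + 1]addrC.
Qed.

Lemma face_boundary (M : nat) zs ys : ~~ odd M -> face zs ys ->
  has (fun y : int => `|y|%N == M) ys -> has (fun y : int => `|y|%N == M) zs.
Proof.
move=> eM; elim: ys zs => [|y ys IH] [|z zs] //= /andP[zy F] /orP[] H; last by rewrite IH ?orbT.
by apply/orP; left; move/eqP: H zy eM => <- zy /negbTE eM; move: zy; rewrite eM orbF => /eqP->.
Qed.

End Cubical.
Arguments facets : simpl never.

(** * A discrete Borsuk-Ulam theorem *)

Section BorsukUlam.
Local Open Scope ring_scope.
Variables (m : nat).

Definition on_boundary (ys : seq int) := has (fun y : int => `|y|%N == m.*2) ys.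

(** The cup product of the coboundaries of the sign functions [th 0], ...,
    [th r.-1]: on a cell of dimension [r] it is the parity of the number of flags
    of faces x_0 < ... < x_r such that each [th i] changes between x_i and
    x_(i+1). *)
Fixpoint cup (th : nat -> seq int -> bool) r (ys : seq int) : bool :=
  if r is r'.+1 then facets (fun zs => cup th r' zs && th r' zs) ys else true.

(** The points with odd coordinates of absolute value less than [m.*2] are the
    cells of full dimension of the cube with half side [m.*2]. *)
Fixpoint sum_odd d (f : seq int -> bool) : bool :=
  if d is d'.+1 then
    \xor_(k < m) (sum_odd d' (fun ys => f (Posz k.*2.+1 :: ys))
              (+) sum_odd d' (fun ys => f (- Posz k.*2.+1 :: ys)))
  else f [::].

Lemma eq_sum_odd d f f' : (forall ys, size ys = d -> f ys = f' ys) -> sum_odd d f = sum_odd d f'.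
Proof.
elim: d f f' => /= [|d IH] f f' E; first exact: E.
by apply: eq_bigr => k _; congr addb; apply: IH => ys sy; rewrite E //= sy.
Qed.

Lemma sum_oddD d f f' : sum_odd d (fun y => f y (+) f' y) = sum_odd d f (+) sum_odd d f'.
Proof.
elim: d f f' => //= d IH f f'; rewrite -big_split; apply: eq_bigr => k _ /=.
by rewrite !IH addbACA.
Qed.

Lemma sum_odd_opps d f : sum_odd d (fun y => f (opps y)) = sum_odd d f.
Proof.
elim: d f => //= d IH f; apply: eq_bigr => k _ /=; rewrite addbC; congr addb.
  by rewrite -[RHS]IH; apply: eq_sum_odd => ys _ /=; rewrite opprK.
by rewrite -[RHS]IH.
Qed.

Lemma sum_odd_false d f : (forall ys, f ys = false) -> sum_odd d f = false.
Proof. by elim: d f => //= d IH f E; rewrite big1 // => k _; rewrite !IH. Qed.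

Lemma telescope n (h : nat -> bool) :
  \xor_(k < n) (h k (+) h k.+1) = h 0%N (+) h n.
Proof.
elim: n => [|n IH]; first by rewrite big_ord0 addbb.
by rewrite big_ord_recr /= IH; case: (h 0%N); case: (h n); case: (h n.+1).
Qed.

Lemma facets_odd_cons g (y : int) ys : odd `|y|%N ->
  facets g (y :: ys) = g (y - 1 :: ys) (+) g (y + 1 :: ys) (+) facets (fun zs => g (y :: zs)) ys.
Proof. by rewrite {1}/facets => ->. Qed.

Lemma facets_even_cons g (y : int) ys : ~~ odd `|y|%N ->
  facets g (y :: ys) = facets (fun zs => g (y :: zs)) ys.
Proof. by rewrite {1}/facets => /negbTE->. Qed.

(** A facet orthogonal to the first axis is shared by two neighbouring cells,
    except at the two ends of the range. *)
Lemma telescope_pos d g :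
  \xor_(k < m) sum_odd d (fun ys => facets g (Posz k.*2.+1 :: ys)) =
  sum_odd d (fun ys => g (0 :: ys)) (+) sum_odd d (fun ys => g (Posz m.*2 :: ys)) (+)
  \xor_(k < m) sum_odd d (facets (fun ys => g (Posz k.*2.+1 :: ys))).
Proof.
rewrite -(telescope m (fun k => sum_odd d (fun ys => g (Posz k.*2 :: ys)))).
rewrite -big_split; apply: eq_bigr => k _ /=; rewrite -!sum_oddD; apply: eq_sum_odd => ys _.
rewrite facets_odd_cons; last by lia.
by congr (_ (+) _ (+) _); congr (g (_ :: _)); lia.
Qed.

Lemma telescope_neg d g :
  \xor_(k < m) sum_odd d (fun ys => facets g (- Posz k.*2.+1 :: ys)) =
  sum_odd d (fun ys => g (0 :: ys)) (+) sum_odd d (fun ys => g (- Posz m.*2 :: ys)) (+)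
  \xor_(k < m) sum_odd d (facets (fun ys => g (- Posz k.*2.+1 :: ys))).
Proof.
rewrite -[0]oppr0 -(telescope m (fun k => sum_odd d (fun ys => g (- Posz k.*2 :: ys)))).
rewrite -big_split; apply: eq_bigr => k _ /=; rewrite -!sum_oddD; apply: eq_sum_odd => ys _.
rewrite facets_odd_cons; last by lia.
rewrite [X in X (+) _ = _]addbC.
by congr (_ (+) _ (+) _); congr (g (_ :: _)); lia.
Qed.

Lemma sum_odd_facets d g : (forall ys, on_boundary ys -> g ys = false) -> sum_odd d (facets g) = false.
Proof.
elim: d g => //= d IH g gb; rewrite big_split /= telescope_pos telescope_neg.
rewrite !(@big1 _ _ _ _ _ _ (fun k : 'I_m => sum_odd d (facets _))); first last.
- by move=> k _; apply: IH => ys b; apply: gb; rewrite /on_boundary /= -/(on_boundary ys) b orbT.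
- by move=> k _; apply: IH => ys b; apply: gb; rewrite /on_boundary /= -/(on_boundary ys) b orbT.
have -> : sum_odd d (fun ys => g (Posz m.*2 :: ys)) = false.
  by apply: sum_odd_false => ys; apply: gb; rewrite /on_boundary /= eqxx.
have -> : sum_odd d (fun ys => g (- Posz m.*2 :: ys)) = false.
  by apply: sum_odd_false => ys; apply: gb; rewrite /on_boundary /= abszN eqxx.
by rewrite !addbF addbb.
Qed.

(** A cup product of cocycles is a cocycle. *)
Lemma facets_cup th r ys : facets (cup th r) ys = false.
Proof. by case: r => [|r]; [exact: facets_true | exact: facetsK]. Qed.

(** As [cup th r] is a cocycle, [th r] may be replaced by its difference with the
    constant [th r ys] in the definition of [cup th r.+1 ys]. *)
Lemma cupS_exists th r ys : cup th r.+1 ys ->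
  exists zs, [/\ face zs ys, cup th r zs & th r zs != th r ys].
Proof.
move=> h; set b := th r ys.
have : facets (fun z => cup th r z && (th r z (+) b)) ys.
  rewrite (@facets_congr _ (fun z => (cup th r z && th r z) (+) (cup th r z && b))).
    by rewrite facetsD facets_andr facets_cup addbF.
  by move=> z _; rewrite andb_addr.
case/facets_exists => z zf /andP[c t]; exists z; split => //.
by move: t; case: (th r z); case: b.
Qed.

Lemma cup_cons0 th r ys : cup th r (0 :: ys) = cup (fun k zs => th k (0 :: zs)) r ys.
Proof. elim: r ys => //= r IH ys.
by rewrite facets_even_cons //; apply: facets_congr => z _; rewrite IH. Qed.

Lemma cup_boundary th th' r ys : (forall k ys, on_boundary ys -> th k ys = th' k ys) -> on_boundary ys ->
  cup th r ys = cup th' r ys.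
Proof.
move=> E; elim: r ys => //= r IH ys b; apply: facets_congr => z zf.
have bz : on_boundary z by apply: face_boundary zf b; rewrite odd_double.
by rewrite IH // E.
Qed.

Lemma cup_opps (th : bool -> nat -> seq int -> bool) r b ys :
  (forall b k ys, th (~~ b) k (opps ys) = ~~ th b k ys) ->
  cup (th (~~ b)) r (opps ys) = cup (th b) r ys.
Proof.
move=> E; elim: r ys => //= r IH ys; rewrite facets_opps.
rewrite -[RHS]addbF -(facets_cup (th b) r ys) -facetsD; apply: facets_congr => z _.
by rewrite IH E; case: (cup _ _ _); case: (th b r z).
Qed.

Section Antipodal.
Variable th : bool -> nat -> seq int -> bool.
Hypothesis odd_th : forall b k ys, th (~~ b) k (opps ys) = ~~ th b k ys.
Hypothesis bd_th : forall b k ys, on_boundary ys -> th b k ys = th true k ys.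

(** Two copies of the cube, told apart by a boolean and glued along their
    boundary by [bd_th], form a sphere on which the antipode changes both the
    copy and the sign of the coordinates. The hemisphere where the first
    coordinate is positive consists of the two halves [hemisphere d true] and
    [hemisphere d false]. *)
Definition hemisphere d b := \xor_(k < m) sum_odd d (fun ys => cup (th b) d.+1 (Posz k.*2.+1 :: ys)).

Definition cup_sign r b ys := cup (th b) r ys && th b r ys.

(** Stokes' formula: the faces on the boundary of the cube belong to both copies
    and cancel, which leaves the equator, where the first coordinate is 0. *)
Lemma hemisphere_equator d : hemisphere d true (+) hemisphere d false =
  sum_odd d (fun ys => cup_sign d true (0 :: ys) (+) cup_sign d false (0 :: ys)).
Proof.
pose gs ys := cup_sign d true ys (+) cup_sign d false ys.
have gbd ys : on_boundary ys -> gs ys = false.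
  move=> b; rewrite /gs /cup_sign (bd_th false) // (@cup_boundary (th true) (th false)) ?addbb // => k zs bz.
  by rewrite (bd_th false).
rewrite /hemisphere -big_split -[sum_odd d _]/(sum_odd d (fun ys => gs (0 :: ys))).
transitivity (\xor_(k < m) sum_odd d (fun ys => facets gs (Posz k.*2.+1 :: ys))).
  by apply: eq_bigr => k _ /=; rewrite -sum_oddD; apply: eq_sum_odd => ys _; rewrite -facetsD.
rewrite telescope_pos [X in _ (+) X (+) _]sum_odd_false ?addbF; last first.
  by move=> ys; rewrite gbd // /on_boundary /= eqxx.
rewrite big1 ?addbF // => k _; apply: sum_odd_facets => ys b.
by apply: gbd; rewrite /on_boundary /= -/(on_boundary ys) b orbT.
Qed.

Lemma cup_sign_opps r b ys : cup_sign r (~~ b) (opps ys) = cup_sign r b ys (+) cup (th b) r ys.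
Proof. by rewrite /cup_sign cup_opps // odd_th; case: cup; case: th. Qed.

End Antipodal.

(** The antipode exchanges the two halves of the equator, which lie one dimension
    lower; as it negates [th d], together they contribute the cup product of the
    [d] remaining sign functions on one of them. *)
Theorem hemisphere_sum d (th : bool -> nat -> seq int -> bool) :
  (forall b k ys, th (~~ b) k (opps ys) = ~~ th b k ys) ->
  (forall b k ys, on_boundary ys -> th b k ys = th true k ys) ->
  hemisphere th d true (+) hemisphere th d false.
Proof.
elim: d th => [|d IH] th odd_th bd_th; rewrite hemisphere_equator //.
  rewrite /= /cup_sign /=.
  by have := odd_th true 0%N [:: 0]; rewrite /= oppr0 => ->; case: (th true _ _).
pose th' b k zs := th b k (0 :: zs).
have {IH} : hemisphere th' d true (+) hemisphere th' d false.
  apply: IH => [b k ys | b k ys h].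
    by rewrite /th' -odd_th /= oppr0.
  by rewrite /th' bd_th // /on_boundary /= -/(on_boundary ys) h orbT.
congr is_true; rewrite /hemisphere -big_split; apply: eq_bigr => k _ /=.
rewrite -[X in _ = _ (+) X]sum_odd_opps -!sum_oddD; apply: eq_sum_odd => ys _.
(* The cells of the equator with negative second coordinate are antipodal to the others. *)
have H b : cup_sign th d.+1 (~~ b) (0 :: - Posz k.*2.+1 :: opps ys) =
   cup_sign th d.+1 b (0 :: Posz k.*2.+1 :: ys) (+) cup (th' b) d.+1 (Posz k.*2.+1 :: ys).
  by rewrite -cup_cons0 -cup_sign_opps //= oppr0.
rewrite (H true : cup_sign th d.+1 false _ = _) (H false : cup_sign th d.+1 true _ = _) /=.
move: (cup_sign _ _ _ _) (cup_sign _ _ _ _) (facets _ _) (facets _ _) => [] [] [] [].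
all: by [].
Qed.

End BorsukUlam.

(** * Necklace splitting *)

Section Necklace.
Local Open Scope ring_scope.

Definition near (D : nat) (zs ys : seq int) :=
  all2 (fun z y : int => (`|z - y|%N <= D)%N) zs ys.

Lemma near_refl D ys : near D ys ys.
Proof. by elim: ys => //= y ys ->; rewrite andbT subrr absz0. Qed.

Lemma near_trans D D' xs ys zs : near D xs ys -> near D' ys zs -> near (D + D') xs zs.
Proof.
elim: xs ys zs => [|x xs IH] [|y ys] [|z zs] //= /andP[a b] /andP[c d].
by rewrite (IH _ _ b d) andbT; lia.
Qed.

Lemma face_near zs ys : face zs ys -> near 1 zs ys.
Proof.
elim: ys zs => [|y ys IH] [|z zs] //= /andP[a b]; rewrite IH // andbT.
by move: a => /orP[/eqP-> | /andP[_ /orP[] /eqP->]]; lia.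
Qed.

Lemma near_leq D D' zs ys : (D <= D')%N -> near D zs ys -> near D' zs ys.
Proof.
move=> le; elim: ys zs => [|y ys IH] [|z zs] //= /andP[a b].
by rewrite IH // andbT (leq_trans a).
Qed.

(** A nonzero cup product provides a flag along which every [th r] changes, so
    that all of them change near the cell [ys]. *)
Lemma cup_changes th n ys r : cup th n ys -> (r < n)%N ->
  exists z z', [/\ near n z ys, near n z' ys & th r z != th r z'].
Proof.
elim: n ys => // n IH ys /cupS_exists[zs [F c t]].
rewrite ltnS leq_eqVlt => /orP[/eqP -> | rn].
  exists zs, ys; split; rewrite ?near_refl //.
  by apply: near_leq (face_near F).
have [z [z' [n1 n2 ne]]] := IH _ c rn.
by exists z, z'; split => //; rewrite -addn1 (near_trans _ (face_near F)).
Qed.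

Variable K : eqType.
Implicit Types (W : seq K) (l : seq int) (c : K).

(** A point of the sphere is a way to share [W] between two owners: the absolute
    values of the coordinates are the lengths of consecutive pieces, their signs
    the owners of these pieces, and the boolean is the owner of what is left. *)
Fixpoint pieces l (b : bool) W : seq (bool * seq K) :=
  if l is x :: l' then (0 < x, take `|x|%N W) :: pieces l' b (drop `|x|%N W) else [:: (b, W)].

Definition sign_of (b : bool) : int := if b then 1 else -1.

Definition imbalance c (ps : seq (bool * seq K)) : int :=
  \sum_(p <- ps) sign_of p.1 * (count_mem c p.2)%:Z.

Lemma flatten_pieces l b W : flatten [seq p.2 | p <- pieces l b W] = W.
Proof. by elim: l W => /= [|x l IH] W; rewrite ?cats0 // IH cat_take_drop. Qed.

Lemma size_pieces l b W : size (pieces l b W) = (size l).+1.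
Proof. by elim: l W => //= x l IH W; rewrite IH. Qed.

Lemma imbalance_cons c p ps :
  imbalance c (p :: ps) = sign_of p.1 * (count_mem c p.2)%:Z + imbalance c ps.
Proof. by rewrite /imbalance big_cons. Qed.

Lemma imbalance_opps c l b W : imbalance c (pieces (opps l) (~~ b) W) = - imbalance c (pieces l b W).
Proof.
elim: l W => [|x l IH] W /=; first by rewrite /imbalance !big_seq1 /=; case: b => /=; lia.
rewrite !imbalance_cons abszN IH opprD; congr (_ + _) => /=.
have [-> | x0] := eqVneq x 0; first by rewrite absz0 take0.
have -> : (0 < - x) = ~~ (0 < x) by lia.
by rewrite /sign_of; case: (0 < x) => /=; lia.
Qed.

Lemma imbalance_nil c l b : imbalance c (pieces l b [::]) = 0.
Proof.
elim: l => [|x l IH] /=; first by rewrite /imbalance big_seq1 mulr0.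
by rewrite imbalance_cons IH /= mulr0.
Qed.

(** On the boundary of a large cube nothing is left after the pieces. *)
Lemma imbalance_boundary c l b b' W m : (size W <= m.*2)%N -> on_boundary m l ->
  imbalance c (pieces l b W) = imbalance c (pieces l b' W).
Proof.
move=> sW; elim: l W sW => //= x l IH W sW /orP[/eqP xm | bl]; rewrite !imbalance_cons.
  by rewrite drop_oversize ?xm // !imbalance_nil.
by rewrite (IH _ _ bl) // size_drop; lia.
Qed.

Fixpoint first_sign l (b : bool) :=
  if l is x :: l' then if x == 0 then first_sign l' b else 0 < x else b.

Lemma first_sign_opps l b : first_sign (opps l) (~~ b) = ~~ first_sign l b.
Proof.
elim: l => //= x l ->; rewrite oppr_eq0; case: eqP => // /eqP x0.
by rewrite oppr_gt0 lt0r x0 /= -ltNge.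
Qed.

Lemma first_sign_boundary l b b' m : on_boundary m.+1 l -> first_sign l b = first_sign l b'.
Proof.
elim: l => //= x l IH /orP[/eqP xm | bl]; first by case: eqP => // x0; move: xm; rewrite x0.
by rewrite (IH bl).
Qed.

(** Ties are broken by the owner of the first piece of nonzero length, whose sign
    is odd under the antipode and does not see the boolean on the boundary. *)
Definition balance_sign c W (b : bool) l :=
  0 < 2 * imbalance c (pieces l b W) + sign_of (first_sign l b).

Lemma balance_sign_opps c W b l : balance_sign c W (~~ b) (opps l) = ~~ balance_sign c W b l.
Proof.
by rewrite /balance_sign imbalance_opps first_sign_opps; case: first_sign => /=; lia.
Qed.

Lemma count_prefix c W s t : (s <= t)%N ->
  (count_mem c (take s W) <= count_mem c (take t W) <= count_mem c (take s W) + (t - s))%N.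
Proof.
move=> st; have -> : take t W = take s W ++ take (t - s) (drop s W).
  by rewrite -[in LHS](subnKC st) takeD.
rewrite count_cat leq_addr leq_add2l.
apply: leq_trans (count_size _ _) _; rewrite size_take; case: ltnP => //; lia.
Qed.

Lemma count_factor c W s n :
  (count_mem c (take n (drop s W)))%:Z =
  (count_mem c (take (s + n) W))%:Z - (count_mem c (take s W))%:Z.
Proof. by rewrite takeD count_cat; lia. Qed.

Fixpoint lip_bound D n e : nat :=
  if n is n'.+1 then (e.*2 + D + lip_bound D n' (e + D))%N else e.

(** A piece either keeps its owner, and its ends move by a bounded amount, or it
    changes owner, and then it is short in both divisions. *)
Lemma imbalance_lip c W b D l l' s s' e : near D l l' -> (`|s%:Z - s'%:Z|%N <= e)%N ->
  (`|imbalance c (pieces l b (drop s W)) - imbalance c (pieces l' b (drop s' W))|%N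
    <= lip_bound D (size l) e)%N.
Proof.
have L u v : (`|(count_mem c (take u W))%:Z - (count_mem c (take v W))%:Z|%N <= `|u%:Z - v%:Z|%N)%N.
  by case: (leqP u v) => [uv | /ltnW uv]; have := count_prefix c W uv; lia.
elim: l l' s s' e => [|x l IH] [|x' l'] s s' e //=.
  move=> _ es; rewrite /imbalance !big_seq1 /=.
  have := count_size (pred1 c) W; have E t := count_cat (pred1 c) (take t W) (drop t W).
  move: (E s) (E s') (L s s'); rewrite !cat_take_drop; case: b => /=; lia.
move=> /andP[xx nl] es; rewrite !imbalance_cons !drop_drop /=.
have es' : (`|(`|x|%N + s)%:Z - (`|x'|%N + s')%:Z|%N <= e + D)%N by lia.
have := IH _ _ _ _ nl es'; rewrite !count_factor.
have := L (s + `|x|)%N (s' + `|x'|)%N; have := L s s'.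
have := L (s + `|x|)%N s; have := L (s' + `|x'|)%N s'.
set A1 := (count_mem c (take (s + `|x|) W))%:Z; set A2 := (count_mem c (take s W))%:Z.
set A3 := (count_mem c (take (s' + `|x'|) W))%:Z; set A4 := (count_mem c (take s' W))%:Z.
move=> d34 d12 d24 d13 hB.
have {}d12 : (`|A1 - A2|%N <= `|x|)%N by apply: leq_trans d12 _; lia.
have {}d34 : (`|A3 - A4|%N <= `|x'|)%N by apply: leq_trans d34 _; lia.
have {}d13 : (`|A1 - A3|%N <= e + D)%N by apply: leq_trans d13 _; lia.
have {}d24 : (`|A2 - A4|%N <= e)%N by apply: leq_trans d24 _.
suff : (`|(sign_of (0 < x) * (A1 - A2) - sign_of (0 < x') * (A3 - A4))%R|%N <= e.*2 + D)%N.
  by move: hB; clear; lia.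
have [same | diff] := eqVneq (0 < x) (0 < x').
  by rewrite same /sign_of; clear - d13 d24; case: (0 < x'); lia.
have {xx diff} xx : (`|x|%N + `|x'|%N <= D)%N by move: diff xx; clear; lia.
by rewrite /sign_of; clear - d12 d34 xx; case: (0 < x); case: (0 < x'); lia.
Qed.

End Necklace.

Section NecklaceSplitting.
Local Open Scope ring_scope.

(** There is one sign function for each colour; where all of them change nearby,
    the Lipschitz property bounds all the imbalances. *)
Theorem necklace_splitting (K : finType) : exists C : nat, forall W : seq K,
  exists ps : seq (bool * seq K), [/\ flatten [seq p.2 | p <- ps] = W,
    (size ps <= #|K|.+1)%N & forall c, (`|imbalance c ps|%N <= C)%N].
Proof.
have [/eqP K0 | Kn0] := boolP (#|K| == 0%N).
  exists 0%N => -[|c W]; last by have := card0_eq K0 c; rewrite inE.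
  by exists [::]; split => // c; rewrite /imbalance big_nil.
have [d Kd] : exists d, #|K| = d.+1 by case: #|K| Kn0 => // d; exists d.
have [c0 _] : exists c : K, true by have /card_gt0P[c _] : (0 < #|K|)%N; [rewrite Kd | exists c].
exists (lip_bound d.+1 d.+1 0) => W.
pose th b r l := balance_sign (nth c0 (enum K) r) W b l.
have H := @hemisphere_sum (size W).+1 d th.
have {H} : hemisphere (size W).+1 th d true (+) hemisphere (size W).+1 th d false.
  apply: H => b r l; first exact: balance_sign_opps.
  move=> bl; rewrite /th /balance_sign (first_sign_boundary _ true bl).
  have sW : (size W <= (size W).+1.*2)%N by lia.
  by rewrite (imbalance_boundary _ b true sW bl).
have ex b : hemisphere (size W).+1 th d b -> exists2 y, size y = d.+1 & cup (th b) d.+1 y.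
  move=> h; apply: contrapT => nex; move: h; rewrite /hemisphere big1 // => k _.
  suff -> : sum_odd (size W).+1 d (fun ys => cup (th b) d.+1 (Posz k.*2.+1 :: ys)) =
            sum_odd (size W).+1 d (fun=> false) by rewrite sum_odd_false.
  apply: eq_sum_odd => ys sy; apply/negP => c; apply: nex.
  by exists (Posz k.*2.+1 :: ys); rewrite //= sy.
move=> hs; have [b [y sy cy]] : exists b, exists2 y, size y = d.+1 & cup (th b) d.+1 y.
  by case ht : (hemisphere _ th d true) hs => hs; [exists true | exists false]; apply: ex.
exists (pieces y b W); split; rewrite ?flatten_pieces ?size_pieces ?sy ?Kd // => c.
have rc : (index c (enum K) < d.+1)%N by rewrite -Kd cardE index_mem mem_enum.
have [z [z' [nz nz']]] := cup_changes cy rc.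
rewrite /th nth_index ?mem_enum // /balance_sign.
have e0 : (`|0%:Z - 0%:Z|%N <= 0)%N by [].
have := imbalance_lip c W b nz e0; have := imbalance_lip c W b nz' e0; rewrite !drop0.
have sz D u v : near D u v -> size u = size v.
  by elim: u v => [|? ? IH] [|? ?] //= /andP[_ /IH->].
rewrite (sz _ _ _ nz) (sz _ _ _ nz') sy.
set B1 := imbalance _ _; set B2 := imbalance _ _; set B3 := imbalance _ _.
rewrite /sign_of; do 2!case: first_sign; lia.
Qed.

End NecklaceSplitting.

(** * Halving the elements of a lattice *)

Section Halving.
Local Open Scope ring_scope.
Variables (E : finType) (L : (E -> int) -> Prop).
Hypothesis L0 : L (fun=> 0).
Hypothesis LB : forall (m : int) z b, L z -> L b -> L (fun e => z e - m * b e).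

(** By induction on the support. If some vectors of [L] are nonzero at [e], choose
    one, [b], with the smallest entry there. This entry divides all the others,
    so that a multiple of [b] clears the entry of [z] at [e], and half of this
    multiple, rounded down, is the correction to the half of what remains. *)
Lemma lattice_halving_on (s : seq E) : exists D : nat, forall z, L z ->
  (forall e, e \notin s -> z e = 0) ->
  exists2 z', L z' & forall e, (`|(z e - 2 * z' e)%R|%N <= D)%N.
Proof.
elim: s => [|e s [D IH]].
  by exists 0%N => z _ z0; exists (fun=> 0) => // e; rewrite z0.
pose P n := exists b, [/\ L b, forall e', e' \notin e :: s -> b e' = 0 & `|b e|%N = n.+1].
have [[n Pn] | nP] := pselect (exists n, P n); last first.
  exists D => z Lz z0; apply: IH => // e' e's; have [-> | ne] := eqVneq e' e.
    have [// | ze] := eqVneq (z e) 0; case: nP; exists (`|z e|%N).-1, z; split=> //.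
    by rewrite prednK // absz_gt0.
  by apply: z0; rewrite inE negb_or ne.
have exP : exists n, `[< P n >] by exists n; apply/asboolP.
case: (ex_minnP exP) => {n Pn exP} n /asboolP[b [Lb b0 bn]] minb.
have be0 : b e != 0 by rewrite -absz_gt0 bn.
exists (D + \sum_e' `|b e'|)%N => z Lz z0.
pose m := (z e %/ b e)%Z; pose r e' := z e' - m * b e'.
have Lr : L r by apply: LB.
have r0 e' : e' \notin e :: s -> r e' = 0 by move=> h; rewrite /r z0 // b0 // mulr0 subr0.
have re : r e = 0.
  have rE : r e = (z e %% b e)%Z by rewrite /r [z e in LHS](divz_eq _ (b e)) addrC addKr.
  have [// | rne] := eqVneq (r e) 0.
  have : P (`|r e|%N).-1 by exists r; split=> //; rewrite prednK // absz_gt0.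
  move=> /asboolP /minb; have := ltz_mod (z e) be0; have := modz_ge0 (z e) be0.
  by move: rne; rewrite -rE; lia.
have [|z' Lz' hz'] := IH r Lr.
  move=> e' e's; have [-> // | ne] := eqVneq e' e.
  by apply: r0; rewrite inE negb_or ne.
exists (fun e' => z' e' - (- (m %/ 2)%Z) * b e'); first exact: LB.
move=> e'; have := hz' e'; rewrite /r.
have : (`|b e'| <= \sum_e' `|b e'|)%N by rewrite (bigD1 e') //= leq_addr.
move: (\sum_e' `|b e'|)%N => S leS h.
have -> : z e' - 2 * (z' e' - - (m %/ 2)%Z * b e') =
  (z e' - m * b e' - 2 * z' e') + (m %% 2)%Z * b e'.
  by rewrite {2}(divz_eq m 2); lia.
have : (m %% 2)%Z = 0 \/ (m %% 2)%Z = 1 by lia.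
by move: h leS; clear; move=> h leS [] ->; lia.
Qed.

Lemma lattice_halving : exists D : nat, forall z, L z ->
  exists2 z', L z' & forall e, (`|(z e - 2 * z' e)%R|%N <= D)%N.
Proof.
have [D H] := lattice_halving_on (enum E); exists D => z Lz; apply: H => // e.
by rewrite mem_enum.
Qed.

End Halving.

(** * Grammars given by the meaning of their nonterminals *)

Section SemanticGrammar.
Variables (Sigma N : finType) (d : N -> nat) (S : N) (bound : nat).
Hypothesis d_gt0 : forall A, 0 < d A.
Hypothesis dS : d S = 1.
Variable sem : forall A, (d A).-tuple (seq Sigma) -> Prop.
Variable weight : forall A, (d A).-tuple (seq Sigma) -> nat.

Definition slot n (B : 'I_n -> N) := {i : 'I_n & 'I_(d (B i))}.
Definition symbol n (B : 'I_n -> N) : finType := (Sigma + {i : 'I_n & 'I_(d (B i))})%type.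

Definition value n (B : 'I_n -> N) (t : forall i, (d (B i)).-tuple (seq Sigma))
  (s : symbol B) : seq Sigma :=
  match s with inl a => [:: a] | inr (existT i j) => tnth (t i) j end.

Definition apply_body n (B : 'I_n -> N) A (body : 'I_(d A) -> seq (symbol B))
  (t : forall i, (d (B i)).-tuple (seq Sigma)) : (d A).-tuple (seq Sigma) :=
  [tuple flatten [seq value t s | s <- body l] | l < d A].

Definition linear_body n (B : 'I_n -> N) A (body : 'I_(d A) -> seq (symbol B)) :=
  forall x : slot B, (\sum_(l < d A) count_mem (inr x : symbol B) (body l) <= 1).

Definition sound_body n (B : 'I_n -> N) A (body : 'I_(d A) -> seq (symbol B)) :=
  forall t, (forall i, sem (t i)) -> sem (apply_body body t).

Definition candidate : finType :=
  {n : 'I_3 & {B : {ffun 'I_n -> N} & {A : N & {ffun 'I_(d A) -> bound.-bseq (symbol (fun i => B i))}}}}.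

Definition cand_arity (r : candidate) : nat := tag r.
Definition cand_rhs (r : candidate) : {ffun 'I_(cand_arity r) -> N} := tag (tagged r).
Definition cand_lhs (r : candidate) : N := tag (tagged (tagged r)).
Definition cand_body (r : candidate) (l : 'I_(d (cand_lhs r))) : seq (symbol (fun i => cand_rhs r i)) :=
  tagged (tagged (tagged r)) l.

Definition good_candidate (r : candidate) :=
  `[< linear_body (@cand_body r) /\ sound_body (@cand_body r) >].

(** The grammar has all the rules of bounded size that are linear and preserve
    the intended meaning [sem] of the nonterminals. It is sound by construction,
    and to show that it is complete it suffices to decompose each tuple into
    smaller ones by one sound rule. *)
Definition semantic_mcfg : mcfg Sigma.
Proof.
refine (@MCFG Sigma N d d_gt0 S dS {r | good_candidate r} (fun r => cand_lhs (val r))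
  (fun r => cand_arity (val r)) (fun r i => cand_rhs (val r) i)
  (fun r l => cand_body l) _).
by move=> r x; have /asboolP[H _] := valP r; apply: H.
Defined.

Hypothesis complete : forall A (w : (d A).-tuple (seq Sigma)), sem w ->
  exists n (B : 'I_n -> N) (body : 'I_(d A) -> seq (symbol B)) t,
  [/\ n < 3 /\ (forall l, size (body l) <= bound), linear_body body, sound_body body,
      forall i, sem (t i) /\ weight (t i) < weight w & apply_body body t = w].

Lemma derives_sem A (w : (d A).-tuple (seq Sigma)) : @derives _ semantic_mcfg A w -> sem w.
Proof.
elim=> r t _ IH; have /asboolP[_ H] := valP r; exact: H IH.
Qed.

Lemma sem_derives A (w : (d A).-tuple (seq Sigma)) : sem w -> @derives _ semantic_mcfg A w.
Proof.
have [k] := ubnP (weight w); elim: k A w => // k IH A w /ltnSE wk sw.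
have [n [B [body [t [[n3 bb] lin snd ht <-]]]]] := complete sw.
(* The candidates form a finite type, so their right-hand sides are finite functions. *)
have EB : B = fun i => [ffun i => B i] i by apply: funext => i; rewrite ffunE.
move: [ffun i => B i] EB => Bf EB; subst B.
pose body' : {ffun 'I_(d A) -> bound.-bseq (symbol (fun i => Bf i))} := [ffun l => Bseq (bb l)].
pose r : candidate := existT _ (Ordinal n3) (existT _ Bf (existT _ A body')).
have bodyE l : cand_body (l : 'I_(d (cand_lhs r))) = body l by rewrite /cand_body /= ffunE.
have bE : @cand_body r = body by apply: funext => l; rewrite bodyE.
have good : good_candidate r by apply/asboolP; rewrite bE.
pose r' : rule semantic_mcfg := exist _ r good.
have <- : @rule_fun _ semantic_mcfg r' t = apply_body body t.
  by apply: eq_mktuple => l; rewrite /= bE.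
refine (@Derives _ semantic_mcfg r' t _) => i; have [si wi] := ht i.
by apply: IH si; apply: leq_trans wk.
Qed.

Lemma semantic_mcf :
  multiple_context_free [set w | sem (tcast (esym dS) [tuple w])]%classic.
Proof.
exists semantic_mcfg; apply/seteqP; split => w /=.
  move=> [t dt tw]; have := derives_sem dt.
  have -> // : tcast (esym dS) [tuple w] = t :> (d S).-tuple _.
  by apply: val_inj; rewrite /= val_tcast; exact: esym tw.
by move=> sw; exists (tcast (esym dS) [tuple w]); [exact: sem_derives | rewrite val_tcast].
Qed.

End SemanticGrammar.

(** * Cutting a tuple of words along a split necklace *)

Section Decode.
Variable E : eqType.
Implicit Types (ps : seq (bool * seq (option E))) (ws : seq (seq E)).

Definition flat (r : seq (bool * seq E)) : seq E := flatten [seq x.2 | x <- r].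

(** The necklace of a tuple of words; the bead [None] marks the beginning of each
    word, so that the words can be recovered and their number is split evenly as
    well. *)
Definition mark_words ws : seq (option E) := flatten [seq None :: map Some w | w <- ws].

Fixpoint unmark (p : seq (option E)) : seq E * seq (seq E) :=
  if p is x :: p' then
    let: (u, us) := unmark p' in if x is Some e then (e :: u, us) else ([::], u :: us)
  else ([::], [::]).

Lemma unmark_mark u ws : unmark (map Some u ++ mark_words ws) = (u, ws).
Proof.
elim: u => [|e u /= ->] //=; elim: ws => //= w ws IH.
by rewrite -/(mark_words ws); elim: w => [|e w] /=; [rewrite IH | case: unmark => ? ? []-> ->].
Qed.

(** Beads are read from right to left. A state consists of the part being read,
    the parts to its right in the same component, and the components that are
    already closed by their mark. *)
Definition cut_state : Type := seq E * seq (bool * seq E) * seq (seq (bool * seq E)).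

Fixpoint cut_piece b (p : seq (option E)) cur rest : cut_state :=
  if p is x :: p' then
    let: (u, cur', rest') := cut_piece b p' cur rest in
    if x is Some e then (e :: u, cur', rest') else ([::], [::], ((b, u) :: cur') :: rest')
  else ([::], cur, rest).

Fixpoint cut_pieces ps : seq (bool * seq E) * seq (seq (bool * seq E)) :=
  if ps is (b, p) :: ps' then
    let: (cur, rest) := cut_pieces ps' in
    let: (u, cur', rest') := cut_piece b p cur rest in ((b, u) :: cur', rest')
  else ([::], [::]).

Definition cut_text (cr : seq (bool * seq E) * seq (seq (bool * seq E))) :=
  map Some (flat cr.1) ++ mark_words (map flat cr.2).

Definition of_cut_state b (s : cut_state) := let: (u, cur, rest) := s in ((b, u) :: cur, rest).

Lemma cut_piece_text b p cur rest :
  cut_text (of_cut_state b (cut_piece b p cur rest)) = p ++ cut_text (cur, rest).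
Proof.
by elim: p => [|[e|] p] //=; case: cut_piece => [[u c] r] /= <-.
Qed.

Lemma cut_pieces_text ps : cut_text (cut_pieces ps) = flatten [seq p.2 | p <- ps].
Proof.
elim: ps => //= -[b p] ps /=; case: cut_pieces => cur rest <-.
by rewrite -(cut_piece_text b); case: cut_piece => [[u c] r].
Qed.

Definition all_parts (cr : seq (bool * seq E) * seq (seq (bool * seq E))) :=
  cr.1 ++ flatten cr.2.

Lemma cut_piece_sum b p cur rest (F : seq E -> nat) (f : E -> nat) (P : pred bool) :
  (forall e u, F (e :: u) = f e + F u) ->
  \sum_(x <- all_parts (of_cut_state b (cut_piece b p cur rest)) | P x.1) F x.2 =
  (if P b then F [::] + \sum_(x <- p) (if x is Some e then f e else F [::]) else 0)
  + \sum_(x <- all_parts (cur, rest) | P x.1) F x.2.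
Proof.
move=> FS; elim: p => [|x p] /=.
  by rewrite big_nil addn0 /all_parts /= big_cons /=; case: ifP.
case: cut_piece => [[u c] r]; rewrite /all_parts /= big_cons /= => IH.
rewrite big_cons; case Pb: (P b) IH => IH.
  by case: x => [e|] /=; rewrite !big_cons /= Pb ?FS; lia.
by case: x => [e|] /=; rewrite !big_cons /= Pb.
Qed.

Lemma cut_pieces_sum ps (F : seq E -> nat) (f : E -> nat) (P : pred bool) :
  (forall e u, F (e :: u) = f e + F u) ->
  \sum_(x <- all_parts (cut_pieces ps) | P x.1) F x.2 =
  \sum_(p <- ps | P p.1) (F [::] + \sum_(x <- p.2) (if x is Some e then f e else F [::])).
Proof.
move=> FS; elim: ps => [|[b p] ps IH] /=; first by rewrite !big_nil.
rewrite big_cons -{}IH; case: cut_pieces => cur rest.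
have := cut_piece_sum b p cur rest P FS; case: cut_piece => [[u c] r] /= ->.
by case: ifP.
Qed.

(** A part begins at the beginning of a piece or after a mark, whence the bound on
    the number of parts of each owner. *)
Lemma cut_components ps ws : flatten [seq p.2 | p <- ps] = mark_words ws ->
  exists rs : seq (seq (bool * seq E)),
  [/\ map flat rs = ws,
      forall b, count (fun x => x.1 == b) (flatten rs) <=
                \sum_(p <- ps | p.1 == b) (count_mem None p.2).+1 &
      forall b e, \sum_(x <- flatten rs | x.1 == b) count_mem e x.2 =
                  \sum_(p <- ps | p.1 == b) count_mem (Some e) p.2].
Proof.
move=> Eps; have Et := cut_pieces_text ps; rewrite {}Eps in Et.
have [c0 rw] : flat (cut_pieces ps).1 = [::] /\ map flat (cut_pieces ps).2 = ws.
  have := congr1 unmark Et; rewrite /cut_text unmark_mark -[mark_words ws]cat0s.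
  by rewrite (unmark_mark [::]) => -[].
exists (cut_pieces ps).2; split=> // b.
  apply: (@leq_trans (\sum_(x <- all_parts (cut_pieces ps) | x.1 == b) 1)).
    by rewrite sum1_count count_cat leq_addl.
  rewrite (@cut_pieces_sum ps (fun=> 1) (fun=> 0) (pred1 b)) //.
  rewrite leq_eqVlt; apply/orP; left; apply/eqP; apply: eq_bigr => p _.
  by rewrite add1n; congr _.+1; rewrite -sum1_count [RHS]big_mkcond; apply: eq_bigr => -[].
move=> e; have FS e' u : count_mem e (e' :: u) = (e' == e) + count_mem e u by [].
have := @cut_pieces_sum ps (count_mem e) _ (pred1 b) FS.
rewrite {1}/all_parts big_cat /= big_seq_cond big1 ?add0n => [-> |x /andP[xc _]].
  apply: eq_bigr => p _; rewrite add0n -sum1_count [RHS]big_mkcond.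
  by apply: eq_bigr => -[e'|] _ //; case: eqP => [->|ne]; rewrite ?eqxx //; case: eqP => // -[].
have : size x.2 <= size (flat (cut_pieces ps).1).
  rewrite /flat size_flatten /shape -map_comp sumnE big_map.
  by rewrite (big_rem x) //= leq_addr.
by rewrite c0 leqn0 => /nilP ->.
Qed.
End Decode.

Section Label.
Variable T : Type.
Implicit Types (al : seq (bool * T)) (L : seq (bool * nat * T)).

(** The parts of each owner are numbered separately: the number is the position
    of the part in the shorter tuple to which it belongs. *)
Fixpoint label (i j : nat) al : seq (bool * nat * T) :=
  if al is (b, x) :: al' then
    (b, if b then i else j, x) :: label (if b then i.+1 else i) (if b then j else j.+1) al'
  else [::].

Definition unlabel (x : bool * nat * T) : bool * T := (x.1.1, x.2).

Lemma map_unlabel i j al : map unlabel (label i j al) = al.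
Proof. by elim: al i j => //= -[b x] al IH i j /=; rewrite IH. Qed.

Lemma label_indices b i j al : [seq x.1.2 | x <- label i j al & x.1.1 == b] =
  iota (if b then i else j) (count (fun x => x.1 == b) al).
Proof.
elim: al i j => [|[b' x] al IH] i j; first by case: b.
by case: b b' IH => -[] IH /=; rewrite ?IH ?add0n ?add1n.
Qed.

Lemma label_blocks k (bs : seq (seq (bool * T))) :
  (forall b, count (fun x => x.1 == b) (flatten bs) = k) ->
  exists blocks : seq (seq (bool * nat * T)), map (map unlabel) blocks = bs /\
    forall b, [seq x.1.2 | x <- flatten blocks & x.1.1 == b] = iota 0 k.
Proof.
move=> ck; pose L := label 0 0 (flatten bs).
have sL : size L = sumn (shape bs) by rewrite -size_flatten -(map_unlabel 0 0 (flatten bs)) size_map.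
exists (reshape (shape bs) L); rewrite map_reshape map_unlabel flattenK; split=> // b.
by rewrite reshapeKr ?sL // label_indices ck; case: b.
Qed.
End Label.

(** * Finite automata with a counter in an abelian group *)

Section Counter.
Local Open Scope ring_scope.
Variables (Sigma Q : finType) (V : zmodType) (st : Sigma -> Q -> Q) (h : Sigma -> Q -> V).

Notation E := (Sigma * Q)%type.
Implicit Types (w : seq Sigma) (q : Q) (a : seq E) (r : seq (bool * seq E)).

(** Words are read from right to left, as products acting on the left. *)
Definition word_state w q := foldr st q w.
Fixpoint word_weight w q : V := if w is a :: w' then h a (word_state w' q) + word_weight w' q else 0.
(** The edges followed by the automaton. *)
Fixpoint annotate w q : seq E := if w is a :: w' then (a, word_state w' q) :: annotate w' q else [::].

Lemma word_state_cat u v q : word_state (u ++ v) q = word_state u (word_state v q).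
Proof. exact: foldr_cat. Qed.

Lemma word_weight_cat u v q : word_weight (u ++ v) q = word_weight u (word_state v q) + word_weight v q.
Proof. by elim: u => /= [|a u ->]; rewrite ?add0r // word_state_cat addrA. Qed.

Lemma annotate_cat u v q : annotate (u ++ v) q = annotate u (word_state v q) ++ annotate v q.
Proof. by elim: u => //= a u ->; rewrite word_state_cat. Qed.

Lemma size_annotate w q : size (annotate w q) = size w.
Proof. by elim: w => //= a w ->. Qed.

Lemma fst_annotate w q : map fst (annotate w q) = w.
Proof. by elim: w => //= a w ->. Qed.

Lemma word_weight_annotate w q : word_weight w q = \sum_(e <- annotate w q) h e.1 e.2.
Proof. by elim: w => /= [|a w ->]; rewrite ?big_nil // big_cons. Qed.

Definition lincomb (z : E -> int) : V := \sum_e h e.1 e.2 *~ z e.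

Lemma lincomb0 : lincomb (fun=> 0) = 0.
Proof. by rewrite /lincomb big1 // => e _; rewrite mulr0z. Qed.

Lemma lincombD z b : lincomb (fun e => z e + b e) = lincomb z + lincomb b.
Proof. by rewrite /lincomb -big_split; apply: eq_bigr => e _; rewrite mulrzDr. Qed.

Lemma lincombZ m z : lincomb (fun e => m * z e) = lincomb z *~ m.
Proof. by rewrite /lincomb mulrz_suml; apply: eq_bigr => e _; rewrite mulrC mulrzA. Qed.

Lemma eq_lincomb z b : z =1 b -> lincomb z = lincomb b.
Proof. by move=> E; apply: eq_bigr => e _; rewrite E. Qed.

Lemma lincomb_seq (a : seq E) : \sum_(e <- a) h e.1 e.2 = lincomb (fun e => count_mem e a).
Proof.
elim: a => [|e a IH]; first by rewrite big_nil; exact: esym lincomb0.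
rewrite big_cons IH -[X in X + _](_ : lincomb (fun e' => (e == e')%:Z) = _).
  by rewrite -lincombD; apply: eq_lincomb => e' /=; rewrite PoszD.
rewrite /lincomb (bigD1 e) //= eqxx mulr1z big1 ?addr0 // => e' /negbTE ne.
by rewrite eq_sym ne mulr0z.
Qed.

Lemma lincomb_sum (I : Type) (s : seq I) (P : pred I) (f : I -> seq E) :
  \sum_(x <- s | P x) \sum_(e <- f x) h e.1 e.2 =
  lincomb (fun e => (\sum_(x <- s | P x) count_mem e (f x))%N).
Proof.
elim: s => [|x s IH]; first by rewrite big_nil -lincomb0; apply: eq_lincomb => e; rewrite big_nil.
rewrite big_cons IH lincomb_seq; case: ifP => Px; last first.
  by apply: eq_lincomb => e; rewrite big_cons Px.
by rewrite -lincombD; apply: eq_lincomb => e; rewrite big_cons Px PoszD.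
Qed.

(** The state attached to a part is reached after everything to its right: a word
    that replaces the part has to be read from this state as well. *)
Fixpoint with_states r q : seq (bool * (seq E * Q)) :=
  if r is (b, a) :: r' then (b, (a, word_state (map fst (flat r')) q)) :: with_states r' q else [::].

Lemma with_states_annotated r w q : flat r = annotate w q ->
  {in with_states r q, forall x, x.2.1 = annotate (map fst x.2.1) x.2.2}.
Proof.
elim: r w => //= -[b a] r IH w; rewrite /flat /= -/(flat r) => fr.
have wE : w = map fst a ++ map fst (flat r) by rewrite -map_cat fr fst_annotate.
have /eqP := fr; rewrite wE annotate_cat eqseq_cat ?size_annotate ?size_map // => /andP[/eqP ea /eqP er].
by move=> x; rewrite inE => /orP[/eqP -> /= | /IH]; [exact: ea | apply; exact: er].
Qed.

Notation elt := (bool * nat * (seq E * Q))%type.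

(** The parts may be replaced by any words that act alike on the states attached
    to them: the regrouping found for one tuple is a sound rule for all. *)
Lemma with_states_sound (bl : seq elt) r q (val : elt -> seq Sigma) :
  map (@unlabel _) bl = with_states r q ->
  {in bl, forall x, word_state (val x) x.2.2 = word_state (map fst x.2.1) x.2.2} ->
  word_state (flatten (map val bl)) q = word_state (map fst (flat r)) q /\
  word_weight (flatten (map val bl)) q = \sum_(x <- bl) word_weight (val x) x.2.2.
Proof.
elim: r bl => [|[b a] r IH] [|x bl] //=; first by rewrite big_nil.
move=> [_ x2 bE] H.
have [|s1 h1] := IH bl bE; first by move=> y yb; apply: H; rewrite inE yb orbT.
have := H x; rewrite inE eqxx => /(_ isT) Hx; move: Hx; rewrite x2 /= => Hx.
rewrite word_state_cat word_weight_cat s1 h1 big_cons x2 /=; split=> //.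
by rewrite /flat /= map_cat word_state_cat.
Qed.

End Counter.

Lemma imbalanceE (K : eqType) (c : K) ps : imbalance c ps =
  ((\sum_(p <- ps | p.1 == true) count_mem c p.2)%N%:Z -
   (\sum_(p <- ps | p.1 == false) count_mem c p.2)%N%:Z)%R.
Proof.
elim: ps => [|[b p] ps IH]; first by rewrite /imbalance !big_nil.
rewrite imbalance_cons IH !big_cons /sign_of; case: b => /=; lia.
Qed.

Lemma count_signs (K : eqType) (c : K) (ps : seq (bool * seq K)) :
  \sum_(p <- ps | p.1 == true) count_mem c p.2 +
  \sum_(p <- ps | p.1 == false) count_mem c p.2 = count_mem c (flatten [seq p.2 | p <- ps]).
Proof.
elim: ps => [|[b p] ps IH]; first by rewrite !big_nil.
by rewrite !big_cons /= count_cat -IH; case: b => /=; lia.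
Qed.

Lemma sum_count_mem (K : finType) (a : seq K) : \sum_e count_mem e a = size a.
Proof.
elim: a => [|x a IH] /=; first by rewrite big1.
by rewrite big_split IH (bigD1 x) //= eqxx big1 // => e /negbTE ne; rewrite eq_sym ne.
Qed.

Section Split.
Variables (Sigma Q : finType) (V : zmodType) (st : Sigma -> Q -> Q) (h : Sigma -> Q -> V).
Notation E := (Sigma * Q)%type.
Variables (C0 D : nat).
Hypothesis necklace : forall W : seq (option E),
  exists ps : seq (bool * seq (option E)), [/\ flatten [seq p.2 | p <- ps] = W,
    (size ps <= #|{: option E}|.+1)%N & forall c, (`|imbalance c ps|%N <= C0)%N].
Hypothesis halving : forall z, lincomb h z = 0%R ->
  exists2 z', lincomb h z' = 0%R & forall e, (`|(z e - 2 * z' e)%R|%N <= D)%N.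

(** Cutting a tuple of [k] words gives each owner at most half of the marks, up to
    [C0], and at most as many further parts as there are pieces, that is
    [#|{: E}|.+2]. The value of [k] makes the sum at most [k]. The value of [C] is
    the solution of [D + C + C0 = 2 * C], see [split_tuple]. *)
Let C := C0 + D.
Let k := (C0 + #|{: E}|.*2 + 3).+1.
Notation elt := (bool * nat * (seq E * Q))%type.

Lemma with_states_signs (r : seq (bool * seq E)) q :
  [seq (y.1, y.2.1) | y <- with_states st r q] = r.
Proof. by elim: r => //= -[b a] r IH /=; congr cons. Qed.

Lemma mark_words_count (ws : seq (seq E)) :
  (count_mem None (mark_words ws) = size ws) *
  (forall e, count_mem (Some e) (mark_words ws) = count_mem e (flatten ws)).
Proof.
split=> [|e]; elim: ws => //= w ws IH.
  rewrite -/(mark_words ws) count_cat IH; congr (_.+1); rewrite count_map.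
  by rewrite (eq_count (a2 := pred0)) ?count_pred0.
by rewrite -/(mark_words ws) !count_cat IH count_map.
Qed.

(** Empty parts are added to the first component until each owner has exactly [k]
    parts, so that no component of the two shorter tuples is lost. *)
Lemma signed_parts (ws : seq (seq E)) : size ws = k ->
  exists rs : seq (seq (bool * seq E)), [/\ map (@flat _) rs = ws,
    forall b, count (fun x => x.1 == b) (flatten rs) = k,
    forall e, \sum_(x <- flatten rs | x.1 == true) count_mem e x.2 +
              \sum_(x <- flatten rs | x.1 == false) count_mem e x.2 = count_mem e (flatten ws) &
    forall e, `|\sum_(x <- flatten rs | x.1 == true) count_mem e x.2 -
               \sum_(x <- flatten rs | x.1 == false) count_mem e x.2| <= C0].
Proof.
move=> sws; have [ps [psW sps imb]] := necklace (mark_words ws).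
have [rs [rsw cnt ecnt]] := cut_components psW.
have cb b : count (fun x => x.1 == b) (flatten rs) <= k.
  apply: leq_trans (cnt b) _.
  have -> : \sum_(p <- ps | p.1 == b) (count_mem None p.2).+1 =
            \sum_(p <- ps | p.1 == b) count_mem None p.2 + count (fun p => p.1 == b) ps.
    by rewrite -sum1_count -big_split; apply: eq_bigr => p _ /=; rewrite addn1.
  have := imb None; rewrite imbalanceE; have := count_signs None ps.
  rewrite psW (mark_words_count ws).1 sws.
  have := count_size (fun p => p.1 == b) ps; move: sps; rewrite card_option /k.
  move: #|_| (count _ _) (size ps) => m n s.
  set A := \sum_(p <- ps | p.1 == true) count_mem None p.2.
  set B := \sum_(p <- ps | p.1 == false) count_mem None p.2.
  have -> : \sum_(p <- ps | p.1 == b) count_mem None p.2 = if b then A else B by case: (b).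
  by case: (b); clearbody A B; lia.
case: rs rsw cnt ecnt cb => [|r rs] rsw cnt ecnt cb; first by move: sws; rewrite -rsw.
pose pad b := nseq (k - count (fun x => x.1 == b) (flatten (r :: rs))) (b, [::] : seq E).
have flat_pad b : flat (pad b) = [::].
  by rewrite /flat /pad map_nseq; elim: (_ - _).
have sum_pad b b' e : \sum_(x <- pad b | x.1 == b') count_mem e x.2 = 0.
  by rewrite big_seq_cond big1 // => x /andP[/nseqP[-> _]].
have E2 b e : \sum_(x <- flatten ((r ++ pad true ++ pad false) :: rs) | x.1 == b) count_mem e x.2
   = \sum_(p <- ps | p.1 == b) count_mem (Some e) p.2.
  by rewrite /= !big_cat /= !sum_pad !addn0 -ecnt /= big_cat.
exists ((r ++ pad true ++ pad false) :: rs); split.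
- by rewrite -rsw /= /flat !map_cat !flatten_cat -!/(flat _) !flat_pad !cats0.
- move=> b; rewrite /= !count_cat /pad !count_nseq.
  have := cb b; have : count (fun x => x.1 == b) (flatten (r :: rs)) =
    count (fun x => x.1 == b) r + count (fun x => x.1 == b) (flatten rs) by rewrite count_cat.
  by case: (b); rewrite /= ?mul1n ?mul0n; lia.
- by move=> e; rewrite !E2 count_signs psW (mark_words_count ws).2.
- by move=> e; rewrite !E2 -imbalanceE.
Qed.

(** If [n] counts the edges of the tuple then [n - c] is a relation between the
    labels, hence at distance at most [D] from [2 * z'] for some relation [z'].
    Each owner has about half of [n], so that subtracting [z'] leaves about half
    of [c], up to [C0] and [D]. A part is shorter than the whole as soon as the
    whole is longer than the total imbalance. *)
Lemma split_tuple (w : k.-tuple (seq Sigma)) (q : 'I_k -> Q) (c : E -> int) :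
  (forall e, `|c e| <= C) -> (\sum_j word_weight st h (tnth w j) (q j) = lincomb h c)%R ->
  #|{: E}| * C0 < \sum_j size (tnth w j) ->
  exists blocks : seq (seq elt),
  [/\ size blocks = k,
      forall l : 'I_k, exists r, map (@unlabel _) (nth [::] blocks l) = with_states st r (q l) /\
         flat r = annotate st (tnth w l) (q l),
      forall b, [seq x.1.2 | x <- flatten blocks & x.1.1 == b] = iota 0 k,
      forall b, exists2 cb : E -> int, (forall e, `|cb e| <= C) &
        (\sum_(x <- flatten blocks | x.1.1 == b) \sum_(e <- x.2.1) h e.1 e.2 = lincomb h cb)%R &
      forall b, \sum_(x <- flatten blocks | x.1.1 == b) size x.2.1 < \sum_j size (tnth w j)].
Proof.
move=> cC sumw large.
pose ws := [seq annotate st (tnth w j) (q j) | j <- enum 'I_k].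
have sws : size ws = k by rewrite size_map size_enum_ord.
have [rs [rsw cnt tot imb]] := signed_parts sws.
have srs : size rs = k by rewrite -sws -rsw size_map.
pose bs := [seq with_states st (nth [::] rs l) (q l) | l : 'I_k <- enum 'I_k].
pose g (y : bool * (seq E * Q)) := (y.1, y.2.1).
have bsrs : map g (flatten bs) = flatten rs.
  rewrite map_flatten /bs -map_comp; congr flatten.
  transitivity [seq nth [::] rs l | l <- map val (enum 'I_k)].
    by rewrite -map_comp; apply: eq_map => l /=; rewrite /g with_states_signs.
  by rewrite val_enum_ord -srs -/(mkseq _ _) mkseq_nth.
have [|blocks [BlE Bli]] := @label_blocks _ k bs.
  by move=> b; rewrite -(cnt b) -bsrs count_map.
have Blrs : [seq (x.1.1, x.2.1) | x <- flatten blocks] = flatten rs.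
  by rewrite -bsrs -BlE -map_flatten -map_comp; apply: eq_map.
have part_rs b (f : seq E -> nat) :
  \sum_(x <- flatten blocks | x.1.1 == b) f x.2.1 = \sum_(x <- flatten rs | x.1 == b) f x.2.
  by rewrite -Blrs big_map.
pose n b e := \sum_(x <- flatten blocks | x.1.1 == b) count_mem e x.2.1.
have ntot e : n true e + n false e = count_mem e (flatten ws) by rewrite /n !part_rs.
have nimb e : `|n true e - n false e| <= C0 by rewrite /n !part_rs.
have size_n b : \sum_(x <- flatten blocks | x.1.1 == b) size x.2.1 = \sum_e n b e.
  by rewrite exchange_big /=; apply: eq_bigr => x _; rewrite sum_count_mem.
have size_w : \sum_j size (tnth w j) = \sum_e n true e + \sum_e n false e.
  rewrite -big_split /=; under [RHS]eq_bigr => e _ do rewrite ntot.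
  rewrite sum_count_mem size_flatten /shape -map_comp sumnE big_map big_enum /=.
  by apply: eq_bigr => j _; rewrite /= size_annotate.
have weight_tot : (lincomb h (fun e => n true e + n false e)%N = lincomb h c)%R.
  rewrite -sumw; under [RHS]eq_bigr => j _ do rewrite word_weight_annotate.
  rewrite (_ : (\sum_j _)%R = \sum_(j <- enum 'I_k) \sum_(e <- annotate st (tnth w j) (q j)) h e.1 e.2)%R;
    last by rewrite big_enum.
  rewrite lincomb_sum; apply: eq_lincomb => e; rewrite ntot /ws count_flatten -map_comp sumnE.
  by rewrite big_map.
have [z' z'0 hz'] : exists2 z', lincomb h z' = 0%R & forall e,
   `|((n true e + n false e)%N%:Z - c e - 2 * z' e)%R| <= D.
  apply: (halving (z := fun e => ((n true e + n false e)%N%:Z - c e)%R)).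
  rewrite (lincombD h _ (fun e => (- c e)%R)) weight_tot.
  rewrite (@eq_lincomb _ _ _ _ (fun e => (- c e)%R) (fun e => (-1) * c e)%R); last first.
    by move=> e; rewrite mulN1r.
  by rewrite lincombZ mulrNz mulr1z subrr.
exists blocks; split=> //.
- by rewrite -(size_map (map (@unlabel _))) BlE size_map size_enum_ord.
- move=> l; exists (nth [::] rs l); split.
    rewrite -(nth_map _ [::] (map (@unlabel _))); last first.
      by rewrite -(size_map (map (@unlabel _))) BlE size_map size_enum_ord.
    by rewrite BlE (nth_map l) ?size_enum_ord // nth_ord_enum.
  rewrite -(nth_map _ [::] (@flat _)) ?srs // rsw (nth_map l) ?size_enum_ord //.
  by rewrite nth_ord_enum.
- move=> b; exists (fun e => (n b e)%:Z - z' e)%R.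
    move=> e; move: (cC e) (hz' e) (nimb e); rewrite /C; case: b; lia.
  rewrite lincomb_sum (lincombD h _ (fun e => (- z' e)%R)).
  rewrite (@eq_lincomb _ _ _ _ (fun e => (- z' e)%R) (fun e => (-1) * z' e)%R); last first.
    by move=> e; rewrite mulN1r.
  by rewrite lincombZ z'0 mul0rz addr0.
- move=> b; rewrite size_n size_w; rewrite size_w in large.
  have : \sum_e n true e <= \sum_e n false e + #|{: E}| * C0 /\
         \sum_e n false e <= \sum_e n true e + #|{: E}| * C0.
    rewrite -sum_nat_const -!big_split; split; apply: leq_sum => e _ /=; move: (nimb e); lia.
  have : 0 < \sum_e n (~~ b) e.
    rewrite lt0n; apply/eqP => n0.
    have : \sum_e n b e <= \sum_e n (~~ b) e + #|{: E}| * C0.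
      rewrite -sum_nat_const -!big_split; apply: leq_sum => e _ /=; move: (nimb e).
      by case: (b) => /=; lia.
    by rewrite n0; move: large; case: (b) n0 => /= ->; lia.
  by case: (b) => /=; lia.
Qed.

End Split.

Section CounterGrammar.
Variables (Sigma Q : finType) (V : zmodType) (st : Sigma -> Q -> Q) (h : Sigma -> Q -> V).
Variable q0 : Q.
Notation E := (Sigma * Q)%type.
Variables (C0 D : nat).
Hypothesis necklace : forall W : seq (option E),
  exists ps : seq (bool * seq (option E)), [/\ flatten [seq p.2 | p <- ps] = W,
    (size ps <= #|{: option E}|.+1)%N & forall c, (`|imbalance c ps|%N <= C0)%N].
Hypothesis halving : forall z, lincomb h z = 0%R ->
  exists2 z', lincomb h z' = 0%R & forall e, (`|(z e - 2 * z' e)%R|%N <= D)%N.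

Let C := C0 + D.
Let k := (C0 + #|{: E}|.*2 + 3).+1.
Notation elt := (bool * nat * (seq E * Q))%type.

(** Except for the start symbol, a nonterminal prescribes for each component the
    states in which reading begins and ends, and the total weight as a
    combination of the labels with coefficients between [- C] and [C]. *)
Definition counter_nt : finType :=
  option ({ffun 'I_k -> Q} * {ffun 'I_k -> Q} * {ffun E -> 'I_(C.*2).+1}).
Definition counter_dim (A : counter_nt) := if A is Some _ then k else 1.
Lemma counter_dim_gt0 A : 0 < counter_dim A. Proof. by case: A. Qed.

(** An ordinal encodes a coefficient shifted by [C]. *)
Definition box (c : {ffun E -> 'I_(C.*2).+1}) (e : E) : int := (Posz (c e) - Posz C)%R.

Lemma box_surj (z : E -> int) : (forall e, `|z e| <= C) -> exists c, box c =1 z.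
Proof.
move=> zC; exists [ffun e => inord `|(z e + Posz C)%R|] => e.
by rewrite /box ffunE inordK; have := zC e; lia.
Qed.

Definition counter_sem (A : counter_nt) : (counter_dim A).-tuple (seq Sigma) -> Prop :=
  match A with
  | None => fun t => word_state st (tnth t ord0) q0 = q0 /\ word_weight st h (tnth t ord0) q0 = 0%R
  | Some (q, p, c) => fun t => (forall j, word_state st (tnth t j) (q j) = p j) /\
      (\sum_j word_weight st h (tnth t j) (q j) = lincomb h (box c))%R
  end.

Definition counter_weight (A : counter_nt) (t : (counter_dim A).-tuple (seq Sigma)) :=
  (A == None) + \sum_i size (tnth t i).

Definition counter_bound := k.*2 + #|{: E}| * C0.

Definition counter_step (A : counter_nt) (w : (counter_dim A).-tuple (seq Sigma)) :=
  exists n (B : 'I_n -> counter_nt) (body : 'I_(counter_dim A) -> seq (symbol Sigma counter_dim B)) t,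
  [/\ n < 3 /\ (forall l, size (body l) <= counter_bound), linear_body body,
      sound_body counter_sem body,
      forall i, counter_sem (t i) /\ counter_weight (t i) < counter_weight w & apply_body body t = w].

(** A word is the concatenation of the components of a tuple whose other
    components are empty. *)
Lemma counter_step_start (w : 1.-tuple (seq Sigma)) : @counter_sem None w -> @counter_step None w.
Proof.
move=> [w1 w2]; have [c c0] : exists c, box c =1 fun=> 0%R by apply: box_surj.
pose qq : {ffun 'I_k -> Q} := [ffun=> q0].
pose B (_ : 'I_1) : counter_nt := Some (qq, qq, c).
pose f (j : 'I_k) : symbol Sigma counter_dim B := inr (existT _ ord0 j).
pose body (_ : 'I_(counter_dim None)) := [seq f j | j <- enum 'I_k].
pose t (i : 'I_1) : (counter_dim (B i)).-tuple (seq Sigma) :=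
  [tuple if j == ord0 then tnth w ord0 else [::] | j < k].
have f_inj : injective f.
  move=> j j' /(congr1 (fun s : symbol Sigma counter_dim B =>
    if s is inr x then nat_of_ord (tagged x) else 0)) /= jj'; exact: val_inj.
exists 1, B, body, t; split.
- by split=> // l; rewrite size_map size_enum_ord /counter_bound; lia.
- move=> x; rewrite big_ord1 /body count_uniq_mem; first by case: (_ \in _).
  by rewrite map_inj_uniq // enum_uniq.
- move=> t' /(_ ord0) /= [H1 H2].
  have {}H1 j : word_state st (tnth (t' ord0) j) q0 = q0 by have := H1 j; rewrite ffunE.
  have {}H2 : (\sum_(j <- enum 'I_k) word_weight st h (tnth (t' ord0) j) q0 = 0)%R.
    transitivity (lincomb h (box c)); last by rewrite (eq_lincomb h c0) lincomb0.
    by rewrite -H2 big_enum; apply: eq_bigr => j _; rewrite ffunE.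
  rewrite tnth_mktuple /body -map_comp -{}H2.
  elim: (enum 'I_k) => [|j s [IH1 IH2]]; first by rewrite /= big_nil.
  by rewrite big_cons /= word_state_cat word_weight_cat IH1 IH2 H1.
- move=> i; split.
    split=> [j|].
      by rewrite tnth_mktuple !ffunE; case: eqP.
    rewrite (eq_lincomb h c0) lincomb0 (bigD1 ord0) //= tnth_mktuple eqxx ffunE w2 add0r.
    by rewrite big1 // => j /negbTE j0; rewrite tnth_mktuple j0.
  rewrite /counter_weight /= big_ord1 (bigD1 ord0) //= tnth_mktuple eqxx big1 ?addn0 //.
  by move=> j /negbTE j0; rewrite tnth_mktuple j0.
- apply: eq_from_tnth => l; rewrite tnth_mktuple /body -map_comp [l]ord1.
  rewrite enum_ordSl /= tnth_mktuple eqxx -map_comp.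
  rewrite (eq_map (g := fun=> [::])); first by elim: (enum _) => [|? ? IH]; rewrite /= ?cats0.
  by move=> j; rewrite /= tnth_mktuple.
Qed.

Lemma counter_step_short X (w : k.-tuple (seq Sigma)) : @counter_sem (Some X) w ->
  \sum_j size (tnth w j) <= #|{: E}| * C0 -> @counter_step (Some X) w.
Proof.
move=> sw short.
pose B (i : 'I_0) : counter_nt := None.
pose body (l : 'I_(counter_dim (Some X))) : seq (symbol Sigma counter_dim B) := map inl (tnth w l).
pose t (i : 'I_0) : (counter_dim (B i)).-tuple (seq Sigma) := [tuple [::]].
have bw t' : apply_body body t' = w.
  apply: eq_from_tnth => l; rewrite tnth_mktuple /body -map_comp.
  by elim: (tnth w l) => //= a s ->.
exists 0, B, body, t; split=> //; last 2 first.
- by move=> t' _; rewrite bw.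
- by case.
- split=> // l; rewrite size_map; apply: leq_trans (leq_addl _ _); apply: leq_trans short.
  by rewrite (bigD1 l) //= leq_addr.
- by move=> [[]].
Qed.

Section Product.
Variables (q p : {ffun 'I_k -> Q}) (c : {ffun E -> 'I_(C.*2).+1}).
Variables (w : k.-tuple (seq Sigma)) (blocks : seq (seq elt)) (c2 : bool -> {ffun E -> 'I_(C.*2).+1}).
Hypothesis w_sem : @counter_sem (Some (q, p, c)) w.
Hypothesis size_blocks : size blocks = k.
Hypothesis blocks_states : forall l : 'I_k, exists r,
  map (@unlabel _) (nth [::] blocks l) = with_states st r (q l) /\ flat r = annotate st (tnth w l) (q l).
Hypothesis blocks_index : forall b, [seq x.1.2 | x <- flatten blocks & x.1.1 == b] = iota 0 k.
Hypothesis blocks_weight : forall b,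
  (\sum_(x <- flatten blocks | x.1.1 == b) \sum_(e <- x.2.1) h e.1 e.2 = lincomb h (box (c2 b)))%R.
Hypothesis blocks_size : forall b,
  \sum_(x <- flatten blocks | x.1.1 == b) size x.2.1 < \sum_j size (tnth w j).

Let x0 : elt := (true, 0, ([::], q0)).
Definition part b i := nth x0 [seq x <- flatten blocks | x.1.1 == b] i.
Definition part_word b i := map fst (part b i).2.1.
Definition part_state b : {ffun 'I_k -> Q} := [ffun i : 'I_k => (part b i).2.2].
Definition part_start b : {ffun 'I_k -> Q} :=
  [ffun i : 'I_k => word_state st (part_word b i) (part b i).2.2].
Definition part_nt (i : 'I_2) : counter_nt :=
  let b := i == ord0 in Some (part_state b, part_start b, c2 b).

Definition bool_ord (b : bool) : 'I_2 := if b then ord0 else ord_max.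

Definition part_var (x : elt) : symbol Sigma counter_dim part_nt :=
  inr (existT (fun i => 'I_(counter_dim (part_nt i))) (bool_ord x.1.1) (inord x.1.2 : 'I_k)).

Definition part_body (l : 'I_(counter_dim (Some (q, p, c)))) := map part_var (nth [::] blocks l).

Lemma size_part b : size [seq x <- flatten blocks | x.1.1 == b] = k.
Proof. by rewrite -(size_map (fun x => x.1.2)) blocks_index size_iota. Qed.

Lemma part_label b i : i < k -> (part b i).1 = (b, i).
Proof.
move=> ik; have := mem_nth x0 (s := [seq x <- flatten blocks | x.1.1 == b]) (n := i).
rewrite size_part ik => /(_ isT); rewrite mem_filter => /andP[/eqP eb _].
have : nth 0 [seq x.1.2 | x <- flatten blocks & x.1.1 == b] i = i by rewrite blocks_index nth_iota.
rewrite (nth_map x0) ?size_part // -/(part b i) => ei.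
by rewrite [LHS]surjective_pairing ei; congr pair; exact: eb.
Qed.

Lemma part_lookup x : x \in flatten blocks -> x.1.2 < k /\ part x.1.1 x.1.2 = x.
Proof.
move=> xB; have xF : x \in [seq y <- flatten blocks | y.1.1 == x.1.1] by rewrite mem_filter eqxx.
have ik : index x [seq y <- flatten blocks | y.1.1 == x.1.1] < k.
  by rewrite -(size_part x.1.1) index_mem.
have px : part x.1.1 (index x [seq y <- flatten blocks | y.1.1 == x.1.1]) = x by rewrite /part nth_index.
have := part_label x.1.1 ik; rewrite px => xl.
have -> : x.1.2 = index x [seq y <- flatten blocks | y.1.1 == x.1.1] by rewrite {1}xl.
by [].
Qed.

Lemma sum_part (R : Type) (idx : R) (op : Monoid.com_law idx) b (F : elt -> R) :
  \big[op/idx]_(x <- flatten blocks | x.1.1 == b) F x = \big[op/idx]_(i < k) F (part b i).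
Proof. by rewrite -big_filter (big_nth x0) size_part big_mkord. Qed.

Lemma big_blocks (R : Type) (idx : R) (op : Monoid.com_law idx) (F : seq elt -> R) :
  \big[op/idx]_(l < k) F (nth [::] blocks l) = \big[op/idx]_(bl <- blocks) F bl.
Proof. by rewrite (big_nth [::]) size_blocks big_mkord. Qed.

Lemma sum_blocks (F : elt -> V) :
  (\sum_(l < k) \sum_(x <- nth [::] blocks l) F x =
   \sum_(i < k) F (part true i) + \sum_(i < k) F (part false i))%R.
Proof.
rewrite -!sum_part (big_blocks _ (fun bl => \sum_(x <- bl) F x)%R) -big_flatten /=.
rewrite (bigID (fun x => x.1.1 == true)) /=; congr (_ + _)%R.
by apply: eq_bigl => x; case: (x.1.1).
Qed.

Lemma part_annotated x : x \in flatten blocks -> x.2.1 = annotate st (map fst x.2.1) x.2.2.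
Proof.
case/flattenP => bl /(nthP [::])[l lk <-]; rewrite size_blocks in lk.
have [r [rE fr]] := blocks_states (Ordinal lk).
move=> xb; have := with_states_annotated fr; rewrite -rE => /(_ (unlabel x)); apply.
by apply: (map_f (@unlabel _) xb).
Qed.

Lemma part_mem b i : i < k -> part b i \in flatten blocks.
Proof.
move=> ik; have : part b i \in [seq x <- flatten blocks | x.1.1 == b].
  by rewrite mem_nth // size_part.
by rewrite mem_filter => /andP[].
Qed.

Lemma lincomb_parts : (lincomb h (box (c2 true)) + lincomb h (box (c2 false)) = lincomb h (box c))%R.
Proof.
case: w_sem => _ <-; rewrite -!blocks_weight !sum_part.
rewrite -(sum_blocks (fun x => \sum_(e <- x.2.1) h e.1 e.2)%R); apply: eq_bigr => l _.
have [r [rE fr]] := blocks_states l; rewrite word_weight_annotate -fr /flat big_flatten big_map.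
have -> : r = [seq (y.1, y.2.1) | y <- map (@unlabel _) (nth [::] blocks l)] by rewrite rE with_states_signs.
by rewrite -map_comp big_map.
Qed.

Lemma part_body_linear : linear_body part_body.
Proof.
move=> [i j]; pose f x := part_var x == inr (existT _ i j).
have -> : \sum_(l < k) count_mem (inr (existT _ i j) : symbol Sigma counter_dim part_nt) (part_body l)
          = count f (flatten blocks).
  rewrite (big_blocks _ (fun bl => count_mem _ (map part_var bl))).
  rewrite count_flatten sumnE big_map; apply: eq_bigr => bl _; rewrite count_map; exact: eq_count.
apply: (@leq_trans (count_mem (nat_of_ord (j : 'I_k)) (iota 0 k))); last first.
  by rewrite count_uniq_mem ?iota_uniq //; case: (_ \in _).
rewrite -(blocks_index (i == ord0)) count_map count_filter.
rewrite (eq_in_count (a1 := f) (a2 := predI f (mem (flatten blocks)))); last first.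
  by move=> x xB; rewrite /= xB andbT.
apply: sub_count => x /= /andP[/eqP fx xB].
have [xk _] := part_lookup xB.
have /= := congr1 (fun s : symbol Sigma counter_dim part_nt => if s is inr y then tag y == ord0 else true) fx.
have /= := congr1 (fun s : symbol Sigma counter_dim part_nt => if s is inr y then nat_of_ord (tagged y) else 0) fx.
by rewrite inordK // => -> <-; rewrite eqxx /=; case: (x.1.1).
Qed.

Lemma bool_ordK b : (bool_ord b == ord0) = b. Proof. by case: b. Qed.

Lemma part_body_sound : sound_body counter_sem part_body.
Proof.
move=> t ht; pose val (x : elt) := value t (part_var x).
have st_val x : x \in flatten blocks -> word_state st (val x) x.2.2 = word_state st (map fst x.2.1) x.2.2.
  move=> xB; have [xk px] := part_lookup xB; have [H _] := ht (bool_ord x.1.1).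
  have := H (inord x.1.2); rewrite !ffunE /part_word bool_ordK inordK // px; exact.
have hw_val b : (\sum_(i < k) word_weight st h (val (part b i)) (part b i).2.2 = lincomb h (box (c2 b)))%R.
  have [_ H] := ht (bool_ord b); rewrite bool_ordK in H; rewrite -H; apply: eq_bigr => i _.
  rewrite ffunE /val /part_var part_label //=; congr (word_weight _ _ (tnth _ _) _); exact: inord_val.
have soundl (l : 'I_k) : word_state st (tnth (apply_body part_body t) l) (q l) = p l /\
   (word_weight st h (tnth (apply_body part_body t) l) (q l) =
    \sum_(x <- nth [::] blocks l) word_weight st h (val x) x.2.2)%R.
  have [r [rE fr]] := blocks_states l.
  have [|E1 E2] := @with_states_sound _ _ _ st h (nth [::] blocks l) r (q l) val rE.
    by move=> x xb; apply: st_val; apply/flattenP; exists (nth [::] blocks l); rewrite ?mem_nth ?size_blocks.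
  rewrite tnth_mktuple -map_comp; split; last exact: E2.
  rewrite -[LHS]/(word_state st (flatten (map val (nth [::] blocks l))) (q l)) E1 fr fst_annotate.
  by case: w_sem.
split=> [l|]; first by case: (soundl l).
rewrite -lincomb_parts -!hw_val -(sum_blocks (fun x => word_weight st h (val x) x.2.2)).
by apply: eq_bigr => l _; case: (soundl l).
Qed.

Lemma counter_step_product : @counter_step (Some (q, p, c)) w.
Proof.
pose t (i : 'I_2) : (counter_dim (part_nt i)).-tuple (seq Sigma) :=
  [tuple part_word (i == ord0) j | j < k].
exists 2, part_nt, part_body, t; split.
- split=> // l; rewrite size_map.
  apply: (@leq_trans (size (flatten blocks))).
    by rewrite size_flatten sumnE big_map -(big_blocks _ size) (bigD1 l) //= leq_addr.
  rewrite -(count_predC (fun x => x.1.1 == true)).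
  have -> : count (predC (fun x => x.1.1 == true)) (flatten blocks) = k.
    by rewrite -(size_part false) size_filter; apply: eq_count => x /=; case: (x.1.1).
  by rewrite -size_filter size_part /counter_bound addnn leq_addr.
- exact: part_body_linear.
- exact: part_body_sound.
- move=> i; rewrite /counter_sem /counter_weight /=; split; last first.
    rewrite !add0n (eq_bigr (fun j : 'I_k => size (part (i == ord0) j).2.1)); last first.
      by move=> j _; rewrite tnth_mktuple size_map.
    by rewrite -(sum_part _ _ (fun x => size x.2.1)).
  split=> [j|]; first by rewrite tnth_mktuple !ffunE.
  rewrite -blocks_weight sum_part; apply: eq_bigr => j _.
  by rewrite tnth_mktuple ffunE word_weight_annotate -part_annotated // part_mem.
- apply: eq_from_tnth => l; rewrite tnth_mktuple -map_comp.
  have [r [rE fr]] := blocks_states l.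
  rewrite -[RHS](fst_annotate st _ (q l)) -fr /flat map_flatten -map_comp.
  have -> : r = [seq (y.1, y.2.1) | y <- map (@unlabel _) (nth [::] blocks l)] by rewrite rE with_states_signs.
  rewrite -!map_comp; congr flatten; apply/eq_in_map => x xb.
  have xB : x \in flatten blocks by apply/flattenP; exists (nth [::] blocks l); rewrite ?mem_nth ?size_blocks.
  have [xk px] := part_lookup xB.
  by rewrite /= tnth_mktuple bool_ordK inordK // /part_word px.
Qed.

End Product.

Lemma counter_complete A (w : (counter_dim A).-tuple (seq Sigma)) : counter_sem w -> counter_step w.
Proof.
case: A w => [[[q p] c]|] w sw; last exact: counter_step_start.
have [short | large] := leqP (\sum_j size (tnth w j)) (#|{: E}| * C0).
  exact: counter_step_short sw short.
have cC e : `|box c e| <= C.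
  by rewrite /box; move: (ltn_ord (c e)); move: (nat_of_ord (c e)) => m; move: (C) => n; lia.
have [_ sumw] := sw.
have [blocks [sB pB iB hB zB]] := split_tuple necklace halving cC sumw large.
have [c2 hc2] : exists c2 : bool -> {ffun E -> 'I_(C.*2).+1}, forall b,
  (\sum_(x <- flatten blocks | x.1.1 == b) \sum_(e <- x.2.1) h e.1 e.2 = lincomb h (box (c2 b)))%R.
  have hb b : exists cb, (\sum_(x <- flatten blocks | x.1.1 == b) \sum_(e <- x.2.1) h e.1 e.2 =
      lincomb h (box cb))%R.
    by have [z zC ->] := hB b; have [cb cbE] := box_surj zC; exists cb; apply: eq_lincomb.
  have [[ct Ht] [cf Hf]] := (hb true, hb false).
  by exists (fun b => if b then ct else cf) => -[].
exact: (counter_step_product sw sB pB iB hc2 zB).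
Qed.

Lemma counter_mcf_of_bounds :
  multiple_context_free [set w | word_state st w q0 = q0 /\ word_weight st h w q0 = 0%R]%classic.
Proof.
have := @semantic_mcf Sigma counter_nt counter_dim None counter_bound counter_dim_gt0 erefl counter_sem counter_weight.
by move=> /(_ counter_complete).
Qed.

End CounterGrammar.

(** A word is reduced to tuples of bounded length by repeated splitting. *)
Theorem counter_mcf (Sigma Q : finType) (V : zmodType) (st : Sigma -> Q -> Q)
  (h : Sigma -> Q -> V) (q0 : Q) :
  multiple_context_free [set w | word_state st w q0 = q0 /\ word_weight st h w q0 = 0%R]%classic.
Proof.
have [C0 necklace] := necklace_splitting (option (Sigma * Q)).
have [||D halving] := @lattice_halving _ (fun z => lincomb h z = 0%R).
- exact: lincomb0.
- move=> m z b z0 b0; rewrite (lincombD h z (fun e => (- (m * b e))%R)) z0 add0r.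
  rewrite (@eq_lincomb _ _ _ _ _ (fun e => ((- m) * b e)%R)); last by move=> e; rewrite mulNr.
  by rewrite lincombZ b0 mul0rz.
exact: counter_mcf_of_bounds necklace halving.
Qed.

(** * The word problem of a virtually abelian group *)

Section Cosets.
Local Open Scope group_scope.
Local Open Scope classical_set_scope.
Variables (G : groupType) (H : set G).
Hypothesis sH : is_subgroup H.

Lemma left_coset_eq x y : H (x^-1 * y) -> left_coset H x = left_coset H y.
Proof.
move=> Hxy; apply/seteqP; split=> _ [z Hz <-].
  exists (y^-1 * x * z); last by rewrite !mulgA mulgV mul1g.
  by apply: (subgroupM sH) => //; have := subgroupV sH Hxy; rewrite invgM invgK.
by exists (x^-1 * y * z); [exact: (subgroupM sH) | rewrite !mulgA mulgV mul1g].
Qed.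

Lemma coset_mem x y : left_coset H x = left_coset H y -> H (x^-1 * y).
Proof.
move=> E; have : left_coset H y y by exists 1; [exact: subgroup1 | rewrite mulg1].
by rewrite -E => -[z Hz <-]; rewrite mulgA mulVg mul1g.
Qed.

Lemma coset_representatives : finite_index H ->
  exists n (t : 'I_n -> G) (cls : G -> 'I_n),
    (forall g, H ((t (cls g))^-1 * g)) /\ (forall g g', H (g^-1 * g') -> cls g = cls g').
Proof.
move=> /finite_seqP[s sE].
have ins g : index (left_coset H g) s < size s.
  rewrite index_mem; have : range (left_coset H) (left_coset H g) by exists g.
  by rewrite sE.
pose cls g := Ordinal (ins g).
have [t ht] : exists t : 'I_(size s) -> G, forall g, left_coset H (t (cls g)) = left_coset H g.
  have rep i : exists x : G, nth set0 s i = left_coset H x \/ ~ exists y, nth set0 s i = left_coset H y.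
    have [[y yE] | no] := pselect (exists y, nth set0 s i = left_coset H y).
      by exists y; left.
    by exists 1; right.
  exists (fun i => projT1 (cid (rep i))) => g.
  have E : nth set0 s (cls g) = left_coset H g.
    rewrite nth_index //; have : range (left_coset H) (left_coset H g) by exists g.
    by rewrite sE.
  by case: cid => x /= [<- // | []]; exists g.
exists (size s), t, cls; split=> [g | g g' gg']; first exact: coset_mem.
by apply: val_inj; rewrite /= (left_coset_eq gg').
Qed.

End Cosets.

Section AbelianType.
Local Open Scope group_scope.
Variables (G : groupType) (H : set G).
Hypotheses (sH : is_subgroup H) (aH : abelian_subgroup H).

(** Additive notation makes the abelian subgroup a value type for counters. *)
Definition subgroup_type of is_subgroup H & abelian_subgroup H := {x : G | H x}.
Let T := subgroup_type sH aH.

HB.instance Definition _ := gen_eqMixin T.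
HB.instance Definition _ := gen_choiceMixin T.

Definition subgroup_zero : T := exist _ 1 (subgroup1 sH).
Definition subgroup_add (x y : T) : T := exist _ (sval x * sval y) (subgroupM sH (svalP x) (svalP y)).
Definition subgroup_opp (x : T) : T := exist _ (sval x)^-1 (subgroupV sH (svalP x)).

Lemma subgroup_type_inj (x y : T) : sval x = sval y -> x = y.
Proof. exact: eq_sig_hprop (fun _ => @Prop_irrelevance _) _ _. Qed.

Lemma subgroup_addA : associative subgroup_add. Proof. by move=> x y z; apply: subgroup_type_inj; rewrite /= mulgA. Qed.
Lemma subgroup_addC : commutative subgroup_add.
Proof. by move=> x y; apply: subgroup_type_inj; apply: aH; apply: svalP. Qed.
Lemma subgroup_add0 : left_id subgroup_zero subgroup_add. Proof. by move=> x; apply: subgroup_type_inj; rewrite /= mul1g. Qed.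
Lemma subgroup_addN : left_inverse subgroup_zero subgroup_opp subgroup_add.
Proof. by move=> x; apply: subgroup_type_inj; rewrite /= mulVg. Qed.

HB.instance Definition _ := GRing.isZmodule.Build T subgroup_addA subgroup_addC subgroup_add0 subgroup_addN.

Lemma sval_zero : sval (0%R : T) = 1. Proof. by []. Qed.
End AbelianType.

Section VirtuallyAbelian.
Local Open Scope group_scope.
Local Open Scope classical_set_scope.
Variables (G : groupType) (Sigma : finType) (inv : Sigma -> Sigma) (pi : seq Sigma -> G).
Hypothesis pi_gen : is_choice_of_generators inv pi.

(** If [t] chooses representatives of the left cosets of [H], reading the letter
    [a] in the coset of [t q] contributes the element of [H] by which
    [pi [:: a] * t q] differs from the representative of its coset. *)
Theorem virtually_abelian_mcf : virtually_abelian G -> multiple_context_free (word_problem pi).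
Proof.
case=> H [sH fH aH]; have [n [t [cls [tH clsE]]]] := coset_representatives sH fH.
pose st (a : Sigma) (q : 'I_n) := cls (pi [:: a] * t q).
pose h (a : Sigma) (q : 'I_n) : subgroup_type sH aH :=
  exist _ ((t (st a q))^-1 * (pi [:: a] * t q)) (tH _).
pose q0 := cls 1.
have cls_t g : cls (t (cls g)) = cls g by apply: clsE.
have track w : word_state st w q0 = cls (pi w * t q0) /\
    t (word_state st w q0) * sval (word_weight st h w q0) = pi w * t q0.
  elim: w => [|a w [IH1 IH2]].
    by rewrite /= (pi_nil pi_gen) mul1g mulg1 cls_t.
  have E : pi (a :: w) = pi [:: a] * pi w by rewrite -(pi_cat pi_gen).
  have E3 : sval (word_weight st h (a :: w) q0) = sval (h a (word_state st w q0)) * sval (word_weight st h w q0) by [].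
  rewrite E -[pi [:: a] * pi w * _]mulgA -IH2 E3; split; last by rewrite /= !mulgA mulgV mul1g.
  by apply: clsE; rewrite !mulgA invgM -!mulgA mulKg mulKg; apply: svalP.
rewrite (_ : word_problem pi = [set w | word_state st w q0 = q0 /\ word_weight st h w q0 = 0%R]).
  exact: counter_mcf.
apply/seteqP; split=> w /=; rewrite /word_problem /=; have [E1 E2] := track w.
  move=> w1; rewrite w1 mul1g in E1 E2; rewrite cls_t in E1; split=> //.
  by apply: subgroup_type_inj; rewrite sval_zero; apply: (mulgI (t q0)); rewrite mulg1 -[in RHS]E2 E1.
case=> s1 h0; move: E2; rewrite s1 h0 sval_zero mulg1 => /esym/eqP.
by rewrite -{2}[t q0]mul1g => /eqP /mulIg.
Qed.
End VirtuallyAbelian.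

(** * Pumping the weights of derivation trees *)

Section Pumping.
Local Open Scope ring_scope.
Variables (N : finType) (V : nmodType) (sz : V -> nat).
Hypothesis sz0 : sz 0 = 0%N.
Hypothesis szD : forall x y, sz (x + y) = (sz x + sz y)%N.
Hypothesis sz_eq0 : forall x, sz x = 0%N -> x = 0.
Variable step : N -> forall k, ('I_k -> N) -> V -> Prop.
Variables K C : nat.
Hypothesis step_bound : forall A k (B : 'I_k -> N) c, step A B c -> (k <= K)%N /\ (sz c <= C)%N.

Implicit Types (X Y : {set N}).

Inductive yields : N -> V -> Prop :=
| Yields A k (B : 'I_k -> N) v c :
    step A B c -> (forall i, yields (B i) (v i)) -> yields A (c + \sum_i v i).

(** Weights of trees in which no nonterminal repeats along a branch; [X] is the set
    of nonterminals met on the way from the root. *)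
Inductive yields_avoiding : {set N} -> N -> V -> Prop :=
| YieldsAvoiding (X : {set N}) A k (B : 'I_k -> N) v c :
    A \notin X -> step A B c -> (forall i, yields_avoiding (A |: X) (B i) (v i)) ->
    yields_avoiding X A (c + \sum_i v i).

Inductive context : N -> N -> V -> Prop :=
| ContextHole A : context A A 0
| ContextStep A k (B : 'I_k -> N) v c i0 A' u :
    step A B c -> context (B i0) A' u -> (forall i, i != i0 -> yields (B i) (v i)) ->
    context A A' (c + \sum_(i | i != i0) v i + u).

Lemma yields_of_avoiding X A v : yields_avoiding X A v -> yields A v.
Proof. by elim=> {}X {}A k B w c _ s _ IH; apply: Yields s IH. Qed.

Lemma yields_context A B u v : context A B u -> yields B v -> yields A (u + v).
Proof.
move=> cx; elim: cx v => {A B u} [A v | A k B w c i0 A' u s _ IH yi v yv]; first by rewrite add0r.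
pose w' i := if i == i0 then u + v else w i.
have -> : c + \sum_(i | i != i0) w i + u + v = c + \sum_i w' i.
  rewrite [in RHS](bigD1 i0) //= /w' eqxx -addrA -[LHS]addrA; congr (_ + _); rewrite addrC.
  by congr (_ + _); apply: eq_bigr => i /negbTE ->.
apply: Yields s _ => i; rewrite /w'; case: eqP => [-> | /eqP ni]; first exact: IH.
exact: yi.
Qed.

Lemma yields_avoiding_sub X Y A v : Y \subset X -> yields_avoiding X A v -> yields_avoiding Y A v.
Proof.
move=> YX h; elim: h Y YX => {X A v} X A k B w c nA s _ IH Y YX.
apply: YieldsAvoiding s _; first by apply: contra nA; apply: (fintype.subsetP YX).
by move=> i; apply: IH; apply: finset.setUS.
Qed.

Lemma sz_sum (k : nat) (P : pred 'I_k) (v : 'I_k -> V) :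
  sz (\sum_(i | P i) v i) = (\sum_(i | P i) sz (v i))%N.
Proof. by elim/big_ind2: _ => // x1 x2 y1 y2 <- <-; rewrite szD. Qed.

Lemma sz_children k (P : pred 'I_k) (v : 'I_k -> V) M : (k <= K)%N ->
  (forall i, P i -> (sz (v i) <= M)%N) -> (sz (\sum_(i | P i) v i) <= K * M)%N.
Proof.
move=> kK h; rewrite sz_sum; apply: (@leq_trans (\sum_(i | P i) M)%N); first exact: leq_sum.
rewrite sum_nat_const; apply: leq_mul => //; apply: leq_trans kK.
by rewrite -[k in (_ <= k)%N]card_ord; apply: max_card.
Qed.

(** Such trees have height at most the number of nonterminals. *)
Lemma avoiding_bounded : exists M, forall X A v, yields_avoiding X A v -> (sz v <= M)%N.
Proof.
suff H n : exists M, forall X A v, (#|finset.setC X| <= n)%N -> yields_avoiding X A v -> (sz v <= M)%N.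
  by have [M HM] := H #|N|; exists M => X A v; apply: HM; apply: max_card.
elim: n => [|n [M IH]].
  exists 0%N => X A v; rewrite leqn0 cards_eq0 => /eqP X0 h; case: h X0 => {}X {}A k B w c nA _ _ X0.
  by have := finset.in_set0 A; rewrite -X0 finset.in_setC nA.
exists (C + K * M)%N => X A v cX h; case: h cX => {}X {}A k B w c nA s h cX.
have [kK cC] := step_bound s; rewrite szD; apply: leq_add => //; apply: sz_children => // i _.
apply: IH (h i); rewrite -ltnS; apply: leq_trans cX; apply: proper_card.
rewrite fintype.properE finset.setCS finset.subsetUr /=; apply/fintype.subsetPn; exists A.
  by rewrite finset.in_setC.
by rewrite finset.in_setC setU11.
Qed.

(** Either [A] can be added to the nonterminals that are avoided, or the tree
    splits at an occurrence of [A]. *)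
Lemma avoiding_split X B v A : yields_avoiding X B v ->
  yields_avoiding (A |: X) B v \/
  exists u v', [/\ context B A u, yields_avoiding finset.set0 A v' & v = u + v'].
Proof.
elim=> {X B v} X B k Bs w c nB s hw IH.
have [BA | BA] := eqVneq B A.
  right; exists 0, (c + \sum_i w i); rewrite add0r BA; split=> //; first exact: ContextHole.
  rewrite -BA; apply: (@yields_avoiding_sub X); first exact: finset.sub0set.
  exact: YieldsAvoiding s hw.
have [[i0 [u [v' [cx y' wE]]]] | none] := pselect (exists i u v',
    [/\ context (Bs i) A u, yields_avoiding finset.set0 A v' & w i = u + v']).
  right; exists (c + \sum_(i | i != i0) w i + u), v'; split=> //.
    by apply: ContextStep s cx _ => i _; apply: yields_of_avoiding (hw i).
  by rewrite (bigD1 i0) //= wE -!addrA; congr (_ + _); rewrite [RHS]addrC -!addrA.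
left; apply: YieldsAvoiding s _; first by rewrite in_setU1 negb_or BA.
move=> i; rewrite finset.setUCA; case: (IH i) => // -[u [v' h]].
by case: none; exists i, u, v'.
Qed.

(** A smallest subtree in which a nonterminal repeats provides a pump of bounded
    weight. If this weight is zero, the repetition is removed without changing
    the total weight. *)
Lemma pump_or_avoid : exists M L, (forall A v, yields_avoiding finset.set0 A v -> (sz v <= M)%N) /\
  forall A v, yields A v -> yields_avoiding finset.set0 A v \/
  exists B u1 u2 v', [/\ context A B u1, context B B u2, yields B v', v = u1 + (u2 + v') &
    (0 < sz u2 <= L)%N].
Proof.
have [M HM] := avoiding_bounded; exists M, (C + K * M + M)%N; split; first exact: HM.
move=> A v; elim=> {A v} A k B w c s yw IH.
have [[i0 [B' [u1 [u2 [v' [c1 c2 y' wE szu]]]]]] | none] := pselect (exists i B' u1 u2 v',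
    [/\ context (B i) B' u1, context B' B' u2, yields B' v', w i = u1 + (u2 + v') &
    (0 < sz u2 <= C + K * M + M)%N]).
  right; exists B', (c + \sum_(i | i != i0) w i + u1), u2, v'; split=> //.
    by apply: ContextStep s c1 _ => i _; apply: yw.
  by rewrite (bigD1 i0) //= wE -!addrA; congr (_ + _); rewrite [RHS]addrC -!addrA.
have wF i : yields_avoiding finset.set0 (B i) (w i).
  by case: (IH i) => // -[B' [u1 [u2 [v' h]]]]; case: none; exists i, B', u1, u2, v'.
(* All children now derive their weights without repetition, so that only [A] can repeat. *)
have [[i0 [u [v' [cx y' wE]]]] | none'] := pselect (exists i u v',
    [/\ context (B i) A u, yields_avoiding finset.set0 A v' & w i = u + v']).
  pose U := c + \sum_(i | i != i0) w i + u.
  have cU : context A A U by apply: ContextStep s cx _ => i _; apply: yw.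
  have vE : c + \sum_i w i = U + v'.
    by rewrite (bigD1 i0) //= wE /U -!addrA; congr (_ + _); rewrite [RHS]addrC -!addrA.
  have [U0 | Upos] := posnP (sz U).
    by left; rewrite vE (sz_eq0 U0) add0r.
  right; exists A, 0, U, v'; split; rewrite ?add0r //; first exact: ContextHole.
    exact: yields_of_avoiding y'.
  rewrite Upos /U !szD; have [kK cC] := step_bound s.
  apply: leq_add; last first.
    by have := HM _ _ _ (wF i0); rewrite wE szD; apply: leq_trans; apply: leq_addr.
  apply: leq_add => //; apply: sz_children => // i _; exact: HM (wF i).
left; apply: YieldsAvoiding s _; first by rewrite finset.in_set0.
move=> i; have [// | [u [v' h]]] := avoiding_split A (wF i).
by case: none'; exists i, u, v'.
Qed.

Theorem pumping : exists L, forall A v, yields A v -> (L < sz v)%N ->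
  exists v0 u, [/\ v = v0 + u, (0 < sz u <= L)%N & yields A (v + u)].
Proof.
have [M [L [HM H]]] := pump_or_avoid; exists (M + L)%N => A v yv big.
have [/HM | [B [u1 [u2 [v' [c1 c2 y' vE /andP[s1 s2]]]]]]] := H _ _ yv; first by move: big; lia.
exists (u1 + v'), u2; split; first by rewrite vE -addrA [v' + u2]addrC.
  by rewrite s1 (leq_trans s2) // leq_addl.
have := yields_context c1 (yields_context c2 (yields_context c2 y')).
by congr yields; rewrite vE -!addrA; do 2!congr (_ + _); rewrite addrC.
Qed.

End Pumping.

(** * Weighted automata running on multiple context-free languages *)

Section Runs.
Local Open Scope ring_scope.
Variables (Sigma Q : finType) (V : nmodType).
Variable trans : Q -> Sigma -> Q -> V -> Prop.

Fixpoint run p (w : seq Sigma) q v : Prop :=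
  if w is a :: w' then
    exists p' v1 v2, [/\ trans p a p' v1, run p' w' q v2 & v = v1 + v2]
  else p = q /\ v = 0.

Lemma run_cat p u w q v : run p (u ++ w) q v <->
  exists p' v1 v2, [/\ run p u p' v1, run p' w q v2 & v = v1 + v2].
Proof.
elim: u p v => [|a u IH] p v /=; split.
- by move=> h; exists p, 0, v; rewrite add0r.
- by case=> p' [v1 [v2 [[-> ->] h ->]]]; rewrite add0r.
- case=> p' [v1 [v2 [ta /IH [p'' [v3 [v4 [r1 r2 ->]]]] ->]]].
  by exists p'', (v1 + v3), v4; split; [exists p', v1, v3 | | rewrite addrA].
- case=> p' [v1 [v2 [[p'' [v3 [v4 [ta r1 ->]]]] r2 ->]]].
  exists p'', v3, (v4 + v2); split; rewrite ?addrA //; apply/IH.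
  by exists p', v4, v2.
Qed.

Section Fits.
Variable X : eqType.
Implicit Types (tau : X -> option (Q * Q)) (s : seq (Sigma + X)) (t : X -> seq Sigma).

(** A run on the body of a rule, in which a variable [x] leads from the first to the
    second state of [tau x]. *)
Fixpoint fits tau p s q c : Prop :=
  match s with
  | [::] => p = q /\ c = 0
  | inl a :: s' => exists p' c1 c2, [/\ trans p a p' c1, fits tau p' s' q c2 & c = c1 + c2]
  | inr x :: s' => exists2 p', tau x = Some (p, p') & fits tau p' s' q c
  end.

Definition expand t (y : Sigma + X) : seq Sigma :=
  match y with inl a => [:: a] | inr x => t x end.

Definition var_part (f : X -> V) (y : Sigma + X) : V := if y is inr x then f x else 0.

Definition comp_run (o : option (Q * Q)) w v :=
  if o is Some pq then run pq.1 w pq.2 v else v = 0.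

Lemma fits_run tau p s q c t f : (forall x, comp_run (tau x) (t x) (f x)) ->
  fits tau p s q c -> run p (flatten (map (expand t) s)) q (c + \sum_(y <- s) var_part f y).
Proof.
move=> H; elim: s p c => [|[a|x] s IH] p c /=.
- by case=> -> ->; rewrite big_nil addr0.
- case=> p' [c1 [c2 [ta ft ->]]]; rewrite big_cons /= add0r.
  by exists p', c1, (c2 + \sum_(y <- s) var_part f y); rewrite addrA; split=> //; apply: IH.
- case=> p' tx ft; apply/run_cat; exists p', (f x), (c + \sum_(y <- s) var_part f y).
  split; [by have := H x; rewrite tx | exact: IH | by rewrite big_cons /= addrCA].
Qed.

Lemma eq_fits tau tau' p s q c : (forall x, inr x \in s -> tau x = tau' x) ->
  fits tau p s q c -> fits tau' p s q c.
Proof.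
elim: s p c => [|[a|x] s IH] p c E //=.
  case=> p' [c1 [c2 [ta ft ->]]]; exists p', c1, c2; split=> //; apply: IH ft => x xs.
  by apply: E; rewrite inE xs orbT.
case=> p' tx ft; exists p'; first by rewrite -E ?inE ?eqxx.
by apply: IH ft => y ys; apply: E; rewrite inE ys orbT.
Qed.

(** Linearity allows the states around the only occurrence of a variable to be
    recorded as a function of the variable. *)
Lemma run_fits p s q v t : (forall x, (count_mem (inr x) s <= 1)%N) ->
  run p (flatten (map (expand t) s)) q v ->
  exists tau f c, [/\ fits tau p s q c,
    forall x, inr x \in s -> tau x <> None /\ comp_run (tau x) (t x) (f x) &
    v = c + \sum_(y <- s) var_part f y].
Proof.
elim: s p v => [|[a|x] s IH] p v lin /=.
- case=> -> ->; exists (fun=> None), (fun=> 0), 0; split=> //.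
  by rewrite big_nil addr0.
- case=> p' [v1 [v2 [ta r ->]]].
  have [|tau [f [c [ft H ->]]]] := IH p' v2 _ r.
    by move=> x; apply: leq_trans (lin x); rewrite /= leq_addl.
  exists tau, f, (v1 + c); split; first by exists p', v1, c.
    by move=> x; rewrite inE => /H.
  by rewrite big_cons /= add0r addrA.
- case/run_cat=> p' [v1 [v2 [r1 r2 ->]]].
  have [|tau [f [c [ft H ->]]]] := IH p' v2 _ r2.
    by move=> y; apply: leq_trans (lin y); rewrite /= leq_addl.
  have xs : inr x \notin s.
    by apply/negP; rewrite -has_pred1 has_count; have := lin x; rewrite /= eqxx; lia.
  pose tau' y := if y == x then Some (p, p') else tau y.
  pose f' y := if y == x then v1 else f y.
  have ne y : inr y \in s -> (y == x) = false.
    by move=> ys; apply: contraNF xs => /eqP <-.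
  exists tau', f', c; split.
  + exists p'; first by rewrite /tau' eqxx.
    by apply: eq_fits ft => y ys; rewrite /tau' ne.
  + move=> y; rewrite inE /tau' /f'; case: (y =P x) => [-> // | nyx].
    by case/orP => [/eqP [yx] | /H //]; case: nyx.
  rewrite big_cons /= {1}/f' eqxx addrCA; congr (_ + (_ + _)).
  apply: eq_big_seq => -[a | y] //= ys; by rewrite /f' ne.
Qed.

End Fits.

Lemma sum_var_part (X : finType) (f : X -> V) (s : seq (Sigma + X)) :
  \sum_(y <- s) var_part f y = \sum_x f x *+ count_mem (inr x) s.
Proof.
elim: s => [|y s IH]; first by rewrite big_nil big1.
rewrite big_cons {}IH; case: y => [a|x] /=; first by rewrite add0r; apply: eq_bigr.
rewrite (bigD1 x) // [RHS](bigD1 x) //= eqxx add1n mulrS addrA; congr (_ + _).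
apply: eq_bigr => z zx; rewrite (_ : (inr x == inr z :> Sigma + X) = false) //.
by apply: contraNF zx => /eqP [->].
Qed.

End Runs.

Section Refinement.
Local Open Scope ring_scope.
Variables (Sigma Q : finType) (V : nmodType) (sz : V -> nat).
Hypothesis sz0 : sz 0 = 0%N.
Hypothesis szD : forall x y, sz (x + y) = (sz x + sz y)%N.
Hypothesis sz_eq0 : forall x, sz x = 0%N -> x = 0.
Variable trans : Q -> Sigma -> Q -> V -> Prop.
Hypothesis trans_bound : forall p a q v, trans p a q v -> (sz v <= 1)%N.
Variable g : mcfg Sigma.

Definition slots (r : rule g) : finType := {i : 'I_(rule_arity r) & 'I_(dim (rule_rhs i))}.
Definition slot_of (r : rule g) i (j : 'I_(dim (rule_rhs i))) : slots r :=
  existT (fun i : 'I_(rule_arity r) => 'I_(dim (rule_rhs i))) i j.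
(** Each component of a nonterminal is given the states around it, or [None] when
    it does not reach the final word: rules may drop some of their variables. *)
Definition refined : finType := {A : nonterminal g & {ffun 'I_(dim A) -> option (Q * Q)}}.
Definition refine A (sg : {ffun 'I_(dim A) -> option (Q * Q)}) : refined := Tagged _ sg.
Definition body (r : rule g) (l : 'I_(dim (rule_lhs r))) : seq (Sigma + slots r) := rule_body l.

Definition refined_child (r : rule g) (tau : slots r -> option (Q * Q)) (i : 'I_(rule_arity r)) : refined :=
  refine [ffun j : 'I_(dim (rule_rhs i)) => tau (slot_of j)].

(** The second condition excludes variables that are given states without being
    used: their weight would not be part of the weight of the result. *)
Inductive rstep : refined -> forall k, ('I_k -> refined) -> V -> Prop :=
| RStep (r : rule g) (sg : {ffun 'I_(dim (rule_lhs r)) -> option (Q * Q)})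
    (tau : slots r -> option (Q * Q)) (cs : 'I_(dim (rule_lhs r)) -> V) :
    (forall l, if sg l is Some pq then fits trans tau pq.1 (body l) pq.2 (cs l) else cs l = 0) ->
    (forall x, tau x <> None -> exists2 l, sg l <> None & inr x \in body l) ->
    rstep (refine sg) (refined_child tau) (\sum_l cs l).

Definition realizes (A : refined) (t : wtuple (tag A)) v :=
  exists2 vs : 'I_(dim (tag A)) -> V,
    forall l, comp_run trans (tagged A l) (tnth t l) (vs l) & v = \sum_l vs l.

Lemma body_linear r (x : slots r) : (\sum_l count_mem (inr x) (body l) <= 1)%N.
Proof. exact: rule_linear. Qed.

(** The variables that carry weight occur exactly once in the components in use. *)
Lemma used_once r (P : pred 'I_(dim (rule_lhs r))) (f : slots r -> V) :
  (forall x, f x = 0 \/ exists2 l, P l & inr x \in body l) ->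
  \sum_(l | P l) \sum_(y <- body l) var_part f y = \sum_i \sum_(j < dim (rule_rhs i)) f (slot_of j).
Proof.
move=> H; rewrite sig_big_dep /=.
under eq_bigr => l _ do rewrite sum_var_part.
rewrite exchange_big /=; apply: eq_big => // -[i j] _; set x := slot_of j.
have [x0 | [l Pl xl]] := H x; first by rewrite x0 big1 // => l _; rewrite mul0rn.
rewrite sumrMnr (_ : (\sum_(l | P l) _)%N = 1%N) //.
apply/eqP; rewrite eqn_leq; apply/andP; split.
  by apply: leq_trans (body_linear x); rewrite [X in (_ <= X)%N](bigID P) /= leq_addr.
by rewrite (bigD1 l) //= ltn_addr // -has_count has_pred1.
Qed.

Lemma rule_funE r (t : rule_args r) l : tnth (rule_fun t) l =
  flatten [seq expand (fun x : slots r => tnth (t (tag x)) (tagged x)) y | y <- body l].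
Proof. by rewrite tnth_mktuple; congr flatten; apply: eq_map => -[a|[i j]]. Qed.

Lemma yields_realized A v : yields rstep A v -> exists t : wtuple (tag A), derives t /\ realizes t v.
Proof.
elim=> {A v} A k B w c s _ IH.
have {}IH : forall i, exists t : wtuple (tag (B i)), derives t /\ realizes t (w i) by exact: IH.
case: s w IH => {A k B c} r sg tau cs Hfit Hused w IH.
pose t : rule_args r := fun i => projT1 (cid (IH i)).
have dt i : derives (t i) by rewrite /t; case: cid => /= ? [].
have rt i : realizes (A := refined_child tau i) (t i) (w i).
  by rewrite /t; case: cid => /= ? [].
have [vs Hvs] : exists vs : forall i, 'I_(dim (rule_rhs i)) -> V,
   forall i, (forall j, comp_run trans (tau (slot_of j)) (tnth (t i) j) (vs i j)) /\ w i = \sum_j vs i j.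
  have ex i : exists vs : 'I_(dim (rule_rhs i)) -> V,
     (forall j, comp_run trans (tau (slot_of j)) (tnth (t i) j) (vs j)) /\ w i = \sum_j vs j.
    have [vs H E] := rt i; exists vs; split=> // j.
    by have := H j; rewrite /= ffunE.
  by exists (fun i => projT1 (cid (ex i))) => i; case: cid.
pose f (x : slots r) := vs (tag x) (tagged x).
have Hf x : comp_run trans (tau x) (tnth (t (tag x)) (tagged x)) (f x).
  by case: x => i j; case: (Hvs i) => H _; exact: H.
exists (rule_fun t); split; first exact: Derives.
exists (fun l => if sg l is Some pq then cs l + \sum_(y <- body l) var_part f y else 0).
  move=> l /=; rewrite rule_funE; have := Hfit l; case: (sg l) => // -[p q] /=.
  exact: fits_run.
have -> : \sum_i w i = \sum_(l | sg l != None) \sum_(y <- body l) var_part f y.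
  rewrite used_once => [|x]; first by apply: eq_bigr => i _; case: (Hvs i).
  have := Hf x; have := Hused x; case tx : (tau x) => [pq|] /=; last by left.
  by case=> // l sl xl _; right; exists l => //; apply/eqP.
rewrite [X in _ + X]big_mkcond -big_split; apply: eq_bigr => l _ /=.
by have := Hfit l; case: (sg l) => [pq|] //= ->; rewrite addr0.
Qed.

Lemma realized_yields A (t : wtuple A) : derives t -> forall sg v,
  realizes (A := refine sg) t v -> yields rstep (refine sg) v.
Proof.
elim=> {A t} r t dt IH sg v [vs Hvs ->] {v}.
have lin l (x : slots r) : (count_mem (inr x) (body l) <= 1)%N.
  by apply: leq_trans (body_linear x); rewrite (bigD1 l) //= leq_addr.
pose T (x : slots r) := tnth (t (tag x)) (tagged x).
have loc1 l : exists tau f c, if sg l is Some pq then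
    [/\ fits trans tau pq.1 (body l) pq.2 c,
      forall x : slots r, inr x \in body l -> tau x <> None /\ comp_run trans (tau x) (T x) (f x) &
      vs l = c + \sum_(y <- body l) var_part f y] else c = 0 :> V.
  have := Hvs l; rewrite rule_funE /=; case: (sg l) => [pq|]; last first.
    by move=> _; exists (fun=> None), (fun=> 0), 0.
  by move=> /run_fits -/(_ (lin l)).
pose taul l := projT1 (cid (loc1 l)).
have loc2 l : exists f c, if sg l is Some pq then
    [/\ fits trans (taul l) pq.1 (body l) pq.2 c,
      forall x : slots r, inr x \in body l -> taul l x <> None /\ comp_run trans (taul l x) (T x) (f x) &
      vs l = c + \sum_(y <- body l) var_part f y] else c = 0 :> V.
  by rewrite /taul; case: cid.
pose fl l := projT1 (cid (loc2 l)).
have loc3 l : exists c, if sg l is Some pq then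
    [/\ fits trans (taul l) pq.1 (body l) pq.2 c,
      forall x : slots r, inr x \in body l -> taul l x <> None /\ comp_run trans (taul l x) (T x) (fl l x) &
      vs l = c + \sum_(y <- body l) var_part (fl l) y] else c = 0 :> V.
  by rewrite /fl; case: cid.
have [cs loc] : exists cs, forall l, if sg l is Some pq then
    [/\ fits trans (taul l) pq.1 (body l) pq.2 (cs l),
      forall x : slots r, inr x \in body l -> taul l x <> None /\ comp_run trans (taul l x) (T x) (fl l x) &
      vs l = cs l + \sum_(y <- body l) var_part (fl l) y] else cs l = 0 :> V.
  by exists (fun l => projT1 (cid (loc3 l))) => l; case: cid.
(* The component in use where a variable occurs fixes its states and its weight. *)
pose home (x : slots r) := [pick l | (sg l != None) && (inr x \in body l)].
have homeE l x : sg l != None -> inr x \in body l -> home x = Some l.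
  move=> sl xl; rewrite /home; case: pickP => [l' /andP[sl' xl'] | /(_ l)]; last by rewrite sl xl.
  congr Some; apply/eqP; apply: contraT => ne.
  have pos l0 : inr x \in body l0 -> (0 < count_mem (inr x) (body l0))%N.
    by rewrite -has_count has_pred1.
  have := body_linear x; rewrite (bigD1 l) //= (bigD1 l') //=.
  have := pos l xl; have := pos l' xl'.
  by move: (count_mem _ (body l)) (count_mem _ (body l')) (\sum_(_ < _ | _) _)%N => a b c; lia.
pose tau x := if home x is Some l then taul l x else None.
pose f x := if home x is Some l then fl l x else 0.
have Hf x : comp_run trans (tau x) (T x) (f x) /\ (home x <> None -> tau x <> None).
  rewrite /tau /f /home; case: pickP => [l /andP[sl xl] | _] //=.
  by have := loc l; case: (sg l) sl => // pq _ [_ H _]; case: (H x xl).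
have vsE l : vs l = cs l + if sg l != None then \sum_(y <- body l) var_part f y else 0.
  have := loc l; have := Hvs l; case sl : (sg l) => [pq|] /=; last by move=> -> ->; rewrite addr0.
  move=> _ [_ _ ->]; congr (_ + _); apply: eq_big_seq => -[a|x] //= xl.
  by rewrite /f (homeE l) ?sl.
have -> : \sum_l vs l = \sum_l cs l + \sum_i \sum_(j < dim (rule_rhs i)) f (slot_of j).
  rewrite -(@used_once r (fun l => sg l != None)) => [|x].
    by rewrite [X in _ + X]big_mkcond -big_split; apply: eq_bigr => l _.
  rewrite /f /home; case: pickP => [l /andP[sl xl] | _]; last by left.
  by right; exists l.
apply: (@Yields _ _ rstep _ _ (refined_child tau)).
  apply: RStep => [l | x].
    have := loc l; case sl : (sg l) => [pq|] // [ft _ _]; apply: eq_fits ft => x xl.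
    by rewrite /tau (homeE l) ?sl.
  rewrite /tau /home; case: pickP => [l /andP[sl xl] _ | //].
  by exists l => //; apply/eqP.
move=> i; apply: IH; exists (fun j => f (slot_of j)) => // j /=.
by rewrite ffunE; case: (Hf (slot_of j)).
Qed.

Lemma fits_sz (X : eqType) (tau : X -> option (Q * Q)) p s q c :
  fits trans tau p s q c -> (sz c <= size s)%N.
Proof.
elim: s p c => [|[a|x] s IH] p c /=; first by case=> _ ->; rewrite sz0.
  by case=> p' [c1 [c2 [/trans_bound b1 /IH b2 ->]]]; rewrite szD -add1n leq_add.
by case=> p' _ /IH b; apply: leqW.
Qed.

Lemma rstep_bound A k (B : 'I_k -> refined) c : rstep A B c ->
  (k <= \sum_(r : rule g) rule_arity r)%N /\
  (sz c <= \sum_(r : rule g) \sum_l size (body (r := r) l))%N.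
Proof.
case=> r sg tau cs Hfit _; split; first by rewrite (bigD1 r) //= leq_addr.
rewrite (bigD1 r) //=; apply: leq_trans (leq_addr _ _).
rewrite sz_sum //; apply: leq_sum => l _; have := Hfit l; case: (sg l) => [pq|->].
  exact: fits_sz.
by rewrite sz0.
Qed.

Lemma start_realizes n (t : n.-tuple (seq Sigma)) p q v : n = 1%N ->
  (exists2 vs : 'I_n -> V, forall l, run trans p (tnth t l) q (vs l) & v = \sum_l vs l) <->
  exists2 w, tval t = [:: w] & run trans p w q v.
Proof.
move=> n1; subst n; split.
  case=> vs H ->; exists (tnth t ord0); last by rewrite big_ord1.
  by case/tupleP: t H => w t _; rewrite (tuple0 t).
case=> w tw rw; exists (fun=> v); last by rewrite big_ord1.
by move=> l; rewrite (tnth_nth w) tw [l]ord1.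
Qed.

Lemma refined_pumping p q : exists K, forall v,
  (exists2 w, language g w & run trans p w q v) -> (K < sz v)%N ->
  exists v0 u, [/\ v = v0 + u, (0 < sz u <= K)%N &
    exists2 w, language g w & run trans p w q (v + u)].
Proof.
have [K HK] := pumping sz0 szD sz_eq0 rstep_bound.
pose A : refined := refine [ffun _ : 'I_(dim (start g)) => Some (p, q)].
have yE v : yields rstep A v <-> exists2 w, language g w & run trans p w q v.
  split=> [/yields_realized [t [dt [vs H vE]]] | [w [t dt tw] rw]].
    have [|w tw rw] := (start_realizes t p q v (dim_start g)).1; last by exists w => //; exists t.
    by exists vs => // l; have := H l; rewrite /= ffunE.
  have [|vs H vE] := (start_realizes t p q v (dim_start g)).2; first by exists w.
  by apply: realized_yields dt _ _ _; exists vs => // l; rewrite /= ffunE.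
exists K => v /yE yv /(HK _ _ yv)[v0 [u [vE su y2]]].
by exists v0, u; split=> //; apply/yE.
Qed.

End Refinement.

(** The runs on a multiple context-free language are derived by the refined
    nonterminals, to which [pumping] applies. *)
Theorem mcf_pumping (Sigma Q : finType) (V : nmodType) (sz : V -> nat)
  (sz0 : sz 0%R = 0) (szD : forall x y, sz (x + y)%R = sz x + sz y)
  (sz_eq0 : forall x, sz x = 0 -> x = 0%R)
  (trans : Q -> Sigma -> Q -> V -> Prop)
  (trans_bound : forall p a q v, trans p a q v -> sz v <= 1)
  (L : set (seq Sigma)) (p q : Q) : multiple_context_free L ->
  exists K, forall v, (exists2 w, L w & run trans p w q v) -> K < sz v ->
  exists v0 u, [/\ v = (v0 + u)%R, 0 < sz u <= K & exists2 w, L w & run trans p w q (v + u)%R].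
Proof. by case=> g <-; apply: refined_pumping. Qed.

(** * Pumping the exponents of products of powers *)

Section Blocks.
Local Open Scope ring_scope.
Variables (Sigma : finType) (m M : nat) (b : nat -> seq Sigma).
Hypothesis b_size : forall i, (0 < size (b i) <= M)%N.

(** The automaton reads the words b_0^(n_0+1) ... b_(m-1)^(n_(m-1)+1). A state is the
    index of the current block with what remains to be read of it, and each
    repetition of block i has weight ['X^i], so that the total weight has
    coefficients n_0, ..., n_(m-1). *)
Definition bstate : finType := option ('I_m * M.-bseq Sigma).

Definition at_state (q : bstate) (i : nat) (s : seq Sigma) : Prop :=
  if q is Some (i', t) then nat_of_ord i' = i /\ bseqval t = s else False.

Definition exit_state (q : bstate) (i : nat) : Prop :=
  if (i.+1 < m)%N then at_state q i.+1 (b i.+1) else q = None.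

Definition btrans (p : bstate) (a : Sigma) (q : bstate) (v : {poly nat}) : Prop :=
  if p is Some (i, s) then
    if bseqval s is a' :: s' then
      a = a' /\ if s' is [::] then (at_state q i (b i) /\ v = 'X^i) \/ (exit_state q i /\ v = 0)
                else at_state q i s' /\ v = 0
    else False
  else False.

Definition weight (v : {poly nat}) : nat := v.[1]%R.

Lemma weight0 : weight 0 = 0%N. Proof. exact: horner0. Qed.
Lemma weightD u v : weight (u + v) = (weight u + weight v)%N. Proof. exact: hornerD. Qed.
Lemma weight_coef n (v : {poly nat}) : (size v <= n)%N -> weight v = (\sum_(i < n) (v`_i)%R)%N.
Proof.
move=> sv; rewrite /weight (horner_coef_wide _ sv).
by apply: eq_bigr => i _; rewrite expr1n mulr1.
Qed.
Lemma weight_eq0 v : weight v = 0%N -> v = 0.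
Proof.
rewrite (weight_coef (leqnn _)) => /eqP; rewrite sum_nat_eq0 => /forallP H.
apply/polyP => i; rewrite coef0; have [si | si] := ltnP i (size v); last by rewrite nth_default.
by have /eqP := H (Ordinal si).
Qed.

Lemma btrans_weight p a q v : btrans p a q v -> (weight v <= 1)%N.
Proof.
case: p => [[i s]|] //=; case: (bseqval s) => // a' [|a'' s'] [_]; last first.
  by case=> _ ->; rewrite weight0.
by case=> -[_ ->]; rewrite ?weight0 // /weight hornerXn expr1n.
Qed.

Definition word_power n (s : seq Sigma) := flatten (nseq n s).

Definition blocks_word i (v : nat -> nat) := flatten [seq word_power (v k).+1 (b k) | k <- iota i (m - i)].

Lemma blocks_wordS i v : (i < m)%N -> blocks_word i v = word_power (v i).+1 (b i) ++ blocks_word i.+1 v.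
Proof. by move=> im; rewrite /blocks_word -(subnSK im). Qed.

Lemma blocks_word0 v i : (m <= i)%N -> blocks_word i v = [::].
Proof. by rewrite -subn_eq0 /blocks_word => /eqP ->. Qed.

Lemma eq_blocks_word i v v' : (forall k, (i <= k)%N -> v k = v' k) -> blocks_word i v = blocks_word i v'.
Proof.
move=> E; congr flatten; apply/eq_in_map => k; rewrite mem_iota => /andP[ik _].
by rewrite E.
Qed.

Lemma block_run_sound w q v : run btrans q w None v ->
  if q is Some (i, s) then
    w = bseqval s ++ word_power (v`_i)%R (b i) ++ blocks_word i.+1 (fun k => (v`_k)%R) /\
    forall k, (k < i)%N -> (v`_k)%R = 0%N
  else w = [::] /\ v = 0.
Proof.
elim: w q v => [|a w IH] q v /=; first by case=> -> ->.
case=> q' [v1 [v2 [ta /IH {}IH ->]]]; case: q ta => [[i s]|] //=.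
case: (bseqval s) => // a' [|a'' s'] [<- {a'}]; last first.
  case: q' IH => [[i' t]|] /=; last by move=> _ [].
  move=> [-> z] [[<- ->] ->]; rewrite add0r.
  by split.
case.
  case: q' IH => [[i' t]|] /=; last by move=> _ [].
  move=> [-> z] [[<- ->] ->]; split; last first.
    by move=> k ki; rewrite coefD coefXn z // (ltn_eqF ki).
  rewrite coefD coefXn eqxx -[(1 + _)%R]/(1 + _)%N add1n /word_power /= -catA; congr (_ :: _ ++ (_ ++ _)).
  apply: eq_blocks_word => k ik; rewrite coefD coefXn.
  by rewrite (_ : (k == i') = false) //; apply/eqP; lia.
rewrite /exit_state; case: ifP => im.
  case: q' IH => [[i' t]|] /=; last by move=> _ [].
  move=> [-> z] [[i'E ->] ->]; rewrite add0r; split; last first.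
    by move=> k ki; apply: z; lia.
  rewrite (z i); last by rewrite i'E.
  by rewrite i'E (blocks_wordS _ im) /word_power /= -catA.
case=> q'N ->; rewrite q'N in IH; case: IH => -> ->; rewrite addr0; split=> [|k _]; last by rewrite coef0.
by rewrite coef0 /= blocks_word0 // leqNgt im.
Qed.

Lemma exists_state i s : (i < m)%N -> (size s <= M)%N -> exists q, at_state q i s.
Proof. by move=> im sM; exists (Some (Ordinal im, Bseq sM)). Qed.

Lemma run_rest i s q q' v : (0 < size s <= M)%N -> (i < m)%N -> at_state q i s ->
  (at_state q' i (b i) /\ v = 'X^i) \/ (exit_state q' i /\ v = 0) -> run btrans q s q' v.
Proof.
move=> /andP[s0 sM] im; elim: s s0 sM q => // a s IH _ sM [[i' t]|] //= [i'E tE] H.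
case: s IH sM tE H => [|a' s] IH sM tE H.
  by exists q', v, 0; rewrite addr0 tE i'E.
have sM' : (size (a' :: s) <= M)%N by apply: ltnW.
have [q1 q1E] := exists_state im sM'.
exists q1, 0, v; rewrite add0r tE i'E; split=> //.
exact: IH.
Qed.

Lemma run_power i n q q' : (i < m)%N -> at_state q i (b i) -> exit_state q' i ->
  run btrans q (word_power n.+1 (b i)) q' ('X^i *+ n).
Proof.
move=> im; elim: n q => [|n IH] q qi q'i.
  by rewrite /word_power /= cats0 mulr0n; apply: run_rest qi _ => //; right.
rewrite /word_power -[nseq _ _]/(b i :: nseq n.+1 (b i)) /= -/(word_power n.+1 (b i)).
have [q1 q1i] := exists_state im (proj2 (andP (b_size i))).
apply/run_cat; exists q1, 'X^i, ('X^i *+ n); rewrite mulrS; split=> //; last exact: IH.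
by apply: run_rest qi _ => //; left.
Qed.

Lemma run_blocks_word i q (v : nat -> nat) : (i < m)%N -> at_state q i (b i) ->
  run btrans q (blocks_word i v) None (\sum_(i <= k < m) 'X^k *+ v k).
Proof.
move=> im; have [n mE] : exists n, m = (i + n).+1 by exists (m - i.+1)%N; lia.
elim: n i im mE q => [|n IH] i im mE q qi; rewrite blocks_wordS // big_ltn //; apply/run_cat.
  have mi : m = i.+1 by lia.
  exists None, ('X^i *+ v i), (\sum_(i.+1 <= k < m) 'X^k *+ v k); split=> //.
    by apply: run_power => //; rewrite /exit_state; case: ifP => //; lia.
  by rewrite blocks_word0 ?big_geq //=; lia.
have im1 : (i.+1 < m)%N by lia.
have [q1 q1i] := exists_state im1 (proj2 (andP (b_size i.+1))).
exists q1, ('X^i *+ v i), (\sum_(i.+1 <= k < m) 'X^k *+ v k); split=> //.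
  by apply: run_power => //; rewrite /exit_state im1.
by apply: IH => //; lia.
Qed.

End Blocks.

(** The automaton turns exponents into weights, to which [mcf_pumping] applies. The
    block [b 0] stands for those beyond the last one, so that all are nonempty. *)
Theorem mcf_block_pumping (Sigma : finType) (m : nat) (b : nat -> seq Sigma) (L : set (seq Sigma)) :
  0 < m -> (forall i, 0 < size (b i)) -> (forall i, m <= i -> b i = b 0) ->
  multiple_context_free L ->
  exists K, forall v : nat -> nat, L (blocks_word m b 0 v) -> K < \sum_(i < m) v i ->
  exists2 u : nat -> nat, 0 < \sum_(i < m) u i <= K & L (blocks_word m b 0 (fun i => v i + u i)).
Proof.
move=> m0 b0 bm mcf; pose M := \max_(i < m) size (b i).
have bM i : 0 < size (b i) <= M.
  rewrite b0 /=; have [im | /bm ->] := ltnP i m.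
    exact: (leq_bigmax (F := fun i : 'I_m => size (b i)) (Ordinal im)).
  exact: (leq_bigmax (F := fun i : 'I_m => size (b i)) (Ordinal m0)).
have [q0 q0E] := exists_state m0 (proj2 (andP (bM 0))).
have [K HK] := mcf_pumping weight0 weightD weight_eq0 (@btrans_weight _ m M b) q0 None mcf.
exists K => v Lv big.
pose V (v : nat -> nat) : {poly nat} := (\sum_(0 <= k < m) 'X^k *+ v k)%R.
have VE w i : ((V w)`_i)%R = if i < m then w i else 0.
  rewrite /V coef_sum big_mkord.
  under eq_bigr => k _ do rewrite coefMn coefXn.
  have [im | im] := ltnP i m; last first.
    rewrite big1 // => k _; rewrite (_ : (i == k) = false) ?mul0rn //.
    by apply/eqP => E; have := ltn_ord k; rewrite -E ltnNge im.
  rewrite (bigD1 (Ordinal im)) //= eqxx big1 ?addr0 => [|k /negbTE ne].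
    by rewrite natn.
  by rewrite eq_sym (_ : (nat_of_ord k == i) = false) ?mul0rn.
have sV (p : {poly nat}) : (forall i, m <= i -> (p`_i)%R = 0) -> weight p = \sum_(i < m) (p`_i)%R.
  by move=> H; apply: weight_coef; apply/leq_sizeP.
have [||v0 [u [vE su [w' L' r']]]] := HK (V v).
- by exists (blocks_word m b 0 v) => //; apply: run_blocks_word.
- rewrite sV => [|i mi]; last by rewrite VE ltnNge mi.
  by under eq_bigr => i _ do rewrite VE ltn_ord.
have u0 i : m <= i -> (u`_i)%R = 0.
  by move=> mi; have := VE v i; rewrite ltnNge mi vE coefD /= => /eqP; rewrite addn_eq0 => /andP[_ /eqP].
have wordE p w : run (@btrans _ m M b) q0 w None p -> w = blocks_word m b 0 (fun k => (p`_k)%R).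
  move=> /block_run_sound; move: q0E; case: (q0) => [[i s]|] //= [-> ->] [-> _].
  by rewrite [RHS]blocks_wordS // /word_power /= -catA.
exists (fun k => (u`_k)%R); first by rewrite -sV.
rewrite (_ : blocks_word m b 0 _ = w') // (wordE _ _ r'); congr flatten; apply/eq_in_map => k.
by rewrite mem_iota subn0 add0n => /andP[_ km]; rewrite coefD VE km.
Qed.

(** * Central commutators in a group with multiple context-free word problem *)

Section Heisenberg.
Local Open Scope group_scope.
Variables (G : groupType) (x y z : G).
Hypotheses (xyz : x * y = y * x * z) (zx : commute z x) (zy : commute z y).

Lemma heis_swap1 q : x * y ^+ q = y ^+ q * x * z ^+ q.
Proof.
elim: q => [|q IH]; first by rewrite !expg0 !mulg1 mul1g.
rewrite expgSr mulgA IH -!mulgA -(commuteX q (commute_sym zy)) (mulgA x) xyz.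
by rewrite -!mulgA expgS.
Qed.

Lemma heis_swap p q : x ^+ p * y ^+ q = y ^+ q * x ^+ p * z ^+ (p * q).
Proof.
elim: p => [|p IH]; first by rewrite mul0n !expg0 !mulg1 mul1g.
rewrite expgS -mulgA IH !mulgA heis_swap1 -!mulgA; congr (_ * (_ * _)).
rewrite mulSn expgnDr !mulgA; congr (_ * _).
exact: (commuteX2 q p zx).
Qed.

Hypothesis z_inf : forall n, 0 < n -> z ^+ n <> 1.

Lemma power_injective a b : z ^+ a = z ^+ b -> a = b.
Proof.
wlog ab : a b / a <= b.
  by move=> H E; case/orP: (leq_total a b) => /H; [exact | move/(_ (esym E))].
move=> E; have z1 : z ^+ (b - a) = 1.
  by apply: (mulgI (z ^+ a)); rewrite -expgnDr subnKC // mulg1.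
by have [ba0 | /z_inf /(_ z1)] := posnP (b - a); [lia |].
Qed.

(** In the Heisenberg group generated by [x] and [y] this is uniqueness of normal
    forms; multiplication by [y] and by [x] compares the exponents one at a time. *)
Lemma heis_relation p q p' q' r :
  x^-1 ^+ p * y^-1 ^+ q * x ^+ p' * y ^+ q' * z^-1 ^+ r = 1 <->
  [/\ p' = p, q' = q & r = (p * q)%N].
Proof.
have E : x^-1 ^+ p * y^-1 ^+ q * x ^+ p' * y ^+ q' * z^-1 ^+ r = 1 <->
         x ^+ p' * y ^+ q' = y ^+ q * x ^+ p * z ^+ r.
  rewrite !expVgn; split=> [H | H].
    have := congr1 (fun g => y ^+ q * x ^+ p * (g * z ^+ r)) H.
    by rewrite mul1g mulgVK -!mulgA mulVKg mulVKg.
  by rewrite -!mulgA (mulgA (x ^+ p')) H !mulgA mulgVK mulVg mul1g mulgV.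
rewrite E; split=> [{E} E | [-> -> ->]]; last exact: heis_swap.
have zxX n m : z ^+ n * x ^+ m = x ^+ m * z ^+ n by exact: commuteX2.
have zyX n m : z ^+ n * y ^+ m = y ^+ m * z ^+ n by exact: commuteX2.
(* Moving a factor [y] through both sides compares the exponents of [x]. *)
have pp : p' = p.
  have : x ^+ p' * y ^+ q' * y = y * (x ^+ p' * y ^+ q') * z ^+ p.
    rewrite E -[y in LHS]expg1 -!mulgA zyX (mulgA (x ^+ p)) heis_swap expg1 muln1.
    by rewrite !mulgA -expgSr -expgS -!mulgA -!expgnDr addnC.
  rewrite -mulgA -expgSr heis_swap heis_swap !mulgA -expgS -!mulgA => /mulgI /mulgI.
  by rewrite -expgnDr => /power_injective; rewrite mulnS; lia.
rewrite {}pp in E *.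
(* Moving a factor [x] through both sides compares the exponents of [y]. *)
have qq : q' = q.
  have : x * (x ^+ p * y ^+ q') = (x ^+ p * y ^+ q') * x * z ^+ q.
    rewrite E !mulgA heis_swap1 -!mulgA; congr (_ * _).
    rewrite -[x in RHS]expg1 (mulgA (z ^+ r)) zxX -!mulgA -!expgnDr addnC expg1 expgnDr.
    rewrite !mulgA -[x in LHS]expg1.
    by rewrite -(mulgA (x ^+ 1)) zxX expg1 !mulgA -expgS expgSr.
  rewrite mulgA -expgS heis_swap heis_swap -!mulgA => /mulgI.
  rewrite (mulgA (z ^+ _)) -[x in RHS]expg1 zxX -!mulgA expg1 mulgA -expgSr => /mulgI.
  by rewrite -expgnDr => /power_injective; rewrite mulSn; lia.
rewrite {}qq in E *; split=> //.
by move: E; rewrite heis_swap => /mulgI /power_injective.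
Qed.

End Heisenberg.

Section CommutatorTorsion.
Local Open Scope group_scope.
Variables (G : groupType) (Sigma : finType) (inv : Sigma -> Sigma) (pi : seq Sigma -> G).
Hypothesis pi_gen : is_choice_of_generators inv pi.

Lemma nonempty_word g : exists2 w, pi w = g & (0 < size w)%N.
Proof.
have [w wg] := pi_surjective pi_gen g; case: (alphabet_nonempty pi_gen) => a.
exists ([:: a; inv a] ++ w) => //.
rewrite (pi_cat pi_gen) -[[:: a; inv a]]/([:: a] ++ [:: inv a]) (pi_cat pi_gen).
by rewrite (pi_inv pi_gen) mulgV mul1g.
Qed.

Lemma pi_power n w : pi (word_power n w) = pi w ^+ n.
Proof.
elim: n => [|n IH]; first exact: pi_nil pi_gen.
by rewrite expgS -IH -(pi_cat pi_gen).
Qed.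

(** The trivial words among the products of powers of [x^-1], [y^-1], [x], [y] and
    [z^-1] are given by a multiplication of exponents, which contradicts
    [mcf_block_pumping]. *)
Theorem mcf_commutator_torsion (x y : G) : multiple_context_free (word_problem pi) ->
  commute [~ x, y] x -> commute [~ x, y] y -> exists2 n, (0 < n)%N & [~ x, y] ^+ n = 1.
Proof.
set z := [~ x, y] => mcf zx zy; apply: contrapT => no_torsion.
have z_inf n : (0 < n)%N -> z ^+ n <> 1 by move=> n0 zn; apply: no_torsion; exists n.
have xyz : x * y = y * x * z by exact: commgC.
have [w0 w0E w0s] := nonempty_word x^-1; have [w1 w1E w1s] := nonempty_word y^-1.
have [w2 w2E w2s] := nonempty_word x; have [w3 w3E w3s] := nonempty_word y.
have [w4 w4E w4s] := nonempty_word z^-1.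
pose b i := nth w0 [:: w0; w1; w2; w3; w4] i.
have b_pos i : (0 < size (b i))%N.
  by rewrite /b; case: i => [|[|[|[|[|i]]]]] //=; rewrite nth_nil.
have b_out i : (5 <= i)%N -> b i = b 0 by move=> i5; rewrite /b nth_default.
have wpE v : word_problem pi (blocks_word 5 b 0 v) <->
    [/\ v 2%N = v 0%N, v 3%N = v 1%N & (v 4%N).+1 = ((v 0%N).+1 * (v 1%N).+1)%N].
  rewrite /word_problem /blocks_word /= cats0 !(pi_cat pi_gen) !pi_power /b /= w0E w1E w2E w3E w4E.
  rewrite -!expgS !mulgA (heis_relation xyz zx zy z_inf); split=> -[].
    by move=> [->] [->] ->.
  by move=> -> -> ->.
have [K HK] := mcf_block_pumping (isT : (0 < 5)%N) b_pos b_out mcf.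
(* Increasing the first two exponents by [a] and [c] increases the last one by at least
   [K.+2 * (a + c)], too much for a pump of size [K]. *)
pose v i := if (i < 4)%N then K.+1 else (K.+2 * K.+2).-1.
have [||u su] := HK v.
- by apply/wpE.
- by rewrite !big_ord_recl big_ord0 /v /=; lia.
move=> /wpE [e2 e3 e4].
have su' : (0 < u 0%N + (u 1%N + (u 2%N + (u 3%N + u 4%N))) <= K)%N.
  by move: su; rewrite !big_ord_recl big_ord0 /= addn0.
rewrite /v /= in e2 e3 e4; clear - su' e2 e3 e4.
move: (u 0%N) (u 1%N) (u 2%N) (u 3%N) (u 4%N) su' e2 e3 e4 => a c a' c' r su' e2 e3.
have [ac | ac] := posnP (a + c)%N; first by move: ac su' e2 e3; clear; lia.
have -> : ((K.+2 * K.+2).-1 + r).+1 = (K.+2 * K.+2 + r)%N by lia.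
have -> : ((K.+1 + a).+1 * (K.+1 + c).+1)%N = (K.+2 * K.+2 + (K.+2 * (a + c) + a * c))%N by lia.
move/addnI => rE; have : (K.+2 <= K.+2 * (a + c))%N by rewrite leq_pmulr.
by move: rE su'; move: (K.+2 * (a + c))%N (a * c)%N; clear; lia.
Qed.
End CommutatorTorsion.

(** * The upper central series *)

Section Upper.
Local Open Scope group_scope.
Variables (G : groupType) (H : set G).
Hypothesis sH : is_subgroup H.
Implicit Types x y z : G.

Lemma commgMl x y z : [~ x * y, z] = [~ x, z] ^ y * [~ y, z].
Proof. by rewrite !commgEr conjgM mulgA -conjMg mulgK. Qed.

Lemma commgMr x y z : [~ x, y * z] = [~ x, z] * [~ x, y] ^ z.
Proof. by rewrite !commgEl conjgM -mulgA -conjMg mulVKg. Qed.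

Fixpoint upper_central i : set G :=
  if i is j.+1 then fun x => H x /\ forall y, H y -> upper_central j [~ x, y] else fun x => x = 1.

Definition normalised (A : set G) := forall x y, A x -> H y -> A (x ^ y).

Lemma H_conj x y : H x -> H y -> H (x ^ y).
Proof. by move=> hx hy; rewrite conjgE; do !apply: (subgroupM sH) => //; apply: (subgroupV sH). Qed.

Lemma upper_normal_subgroup i : is_subgroup (upper_central i) /\ normalised (upper_central i).
Proof.
elim: i => [|i [sZ nZ]].
  split; first split=> //=; first by move=> x y -> ->; rewrite mulg1.
    by move=> x ->; rewrite invg1.
  by move=> x y -> _; rewrite /= conj1g.
have Zinv x y : H x -> H y -> upper_central i [~ x, y] -> upper_central i [~ x^-1, y].
  move=> hx hy zx.
  have -> : [~ x^-1, y] = ([~ x, y]^-1) ^ x^-1.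
    have := comm1g y; rewrite -{1}(mulgV x) commgMl => /mulg1_eq <-.
    by rewrite conjVg.
  by apply: nZ; [apply: (subgroupV sZ) | apply: (subgroupV sH)].
split; first split=> /=.
- by split=> [|y _]; [exact: subgroup1 | rewrite comm1g; exact: subgroup1].
- move=> x y [hx zx] [hy zy]; split=> [|w hw]; first exact: (subgroupM sH).
  rewrite commgMl; apply: (subgroupM sZ); last exact: zy.
  by apply: nZ => //; apply: zx.
- move=> x [hx zx]; split=> [|w hw]; first exact: (subgroupV sH).
  by apply: Zinv => //; apply: zx.
- move=> x y [hx zx] hy; split=> [|w hw]; first exact: H_conj.
  rewrite -[w](conjgKV y) -conjRg; apply: nZ => //; apply: zx.
  by apply: H_conj => //; apply: (subgroupV sH).
Qed.

Lemma upper_subgroup i : is_subgroup (upper_central i). Proof. by case: (upper_normal_subgroup i). Qed.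
Lemma upper_conj i : normalised (upper_central i). Proof. by case: (upper_normal_subgroup i). Qed.

Lemma upper_sub i x : upper_central i x -> H x.
Proof. by case: i => [->|i []] //; exact: subgroup1. Qed.

Lemma upper_centralS i x : upper_central i x -> upper_central i.+1 x.
Proof.
move=> zx; split=> [|y hy]; first exact: upper_sub zx.
rewrite commgEl; apply: (subgroupM (upper_subgroup i)).
  exact: (subgroupV (upper_subgroup i)).
exact: upper_conj.
Qed.

Lemma lower_central_sub i x : lower_central H i x -> H x.
Proof.
elim: i x => //= i IH x; apply => /=; split=> //.
by move=> _ [y hy [z hz <-]]; rewrite commgEl; apply: (subgroupM sH);
  [apply: (subgroupV sH); apply: IH | apply: H_conj => //; apply: IH].
Qed.

(** The index is a successor so that the series can be followed down to the centre
    of [H], the term of index 1. *)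
Lemma upper_exhausts : nilpotent_subgroup H -> exists n, forall x, H x -> upper_central n.+1 x.
Proof.
case=> n Hn; exists n => x hx; apply: upper_centralS.
suff L i : (i <= n)%N -> forall y, lower_central H (n - i) y -> upper_central i y.
  by apply: (L n) => //; rewrite subnn.
elim: i => [|i IH] ile y; first by rewrite subn0 Hn.
move=> ly; split=> [|z hz]; first exact: lower_central_sub ly.
apply: IH (ltnW ile) _ _; rewrite (_ : n - i = (n - i.+1).+1)%N /=; last by lia.
by move=> K [sK KL]; apply: KL; exists y => //; exists z.
Qed.

End Upper.

(** * Subgroups of finite index *)

Section FiniteIndex.
Local Open Scope group_scope.
Variable G : groupType.

Definition covers (R : seq G) (A B : set G) := forall g, A g -> exists2 r, r \in R & B (r^-1 * g).

Lemma finite_indexP (K : set G) : is_subgroup K ->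
  finite_index K <-> exists R, covers R [set: G]%classic K.
Proof.
move=> sK; split.
  move=> /(coset_representatives sK)[n [t [cls [tK _]]]]; exists (map t (enum 'I_n)) => g _.
  by exists (t (cls g)); rewrite ?map_f ?mem_enum.
case=> R RK; apply: (@sub_finite_set _ _ (left_coset K @` [set` R])%classic).
  move=> _ [g _ <-]; have [r rR rg] := RK g I; exists r => //; exact: left_coset_eq.
by apply: finite_image; apply: finite_seq.
Qed.

Lemma covers_trans R R' (A B C : set G) : covers R A B -> covers R' B C ->
  exists R'', covers R'' A C.
Proof.
move=> RA RB; exists [seq r * r' | r <- R, r' <- R'] => g /RA[r rR /RB[r' rR' Cg]].
by exists (r * r'); [apply: allpairs_f | rewrite invgM -mulgA].
Qed.

Definition prodl (l : seq G) : G := foldr (fun x y => x * y) 1 l.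

Variables (Sigma : finType) (inv : Sigma -> Sigma) (pi : seq Sigma -> G).
Hypothesis pi_gen : is_choice_of_generators inv pi.

(** Schreier's lemma: the generators of [K] are the elements of [K] that the letters
    contribute when they act on the representatives of the cosets. *)
Lemma schreier (K : set G) : is_subgroup K -> finite_index K ->
  exists s : seq G, (forall x, x \in s -> K x) /\
    forall g, K g -> exists2 l, {subset l <= s} & g = prodl l.
Proof.
move=> sK /(coset_representatives sK)[n [t [cls [tK clsE]]]].
pose h (aq : Sigma * 'I_n) := (t (cls (pi [:: aq.1] * t aq.2)))^-1 * (pi [:: aq.1] * t aq.2).
pose q0 := cls 1.
have cls_t g : cls (t (cls g)) = cls g by apply: clsE.
have track w : exists2 l, {subset l <= map h (enum [set: Sigma * 'I_n]%SET)} &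
    pi w * t q0 = t (cls (pi w * t q0)) * prodl l.
  elim: w => [|a w [l ls IH]]; first by exists [::] => //; rewrite (pi_nil pi_gen) mul1g cls_t mulg1.
  have E : pi (a :: w) = pi [:: a] * pi w by rewrite -(pi_cat pi_gen).
  have cE : cls (pi w * t q0) = cls (pi w * t q0) by [].
  move: {2}(cls (pi w * t q0)) cE (IH) => c cE {}IH; rewrite cE in IH.
  exists (h (a, c) :: l).
    by move=> x; rewrite inE => /orP[/eqP -> | /ls //]; rewrite map_f // mem_enum finset.in_setT.
  have -> : cls (pi (a :: w) * t q0) = cls (pi [:: a] * t c).
    apply: esym; apply: clsE; rewrite -cE E -[pi [:: a] * pi w * _]mulgA invgM -mulgA mulKg.
    exact: tK.
  by rewrite /= /h /= !mulgA mulgV mul1g E -[LHS]mulgA IH mulgA.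
exists (map h (enum [set: Sigma * 'I_n]%SET)); split; first by move=> _ /mapP[aq _ ->]; apply: tK.
move=> g Kg; have [w wE] := pi_surjective pi_gen (t q0 * g * (t q0)^-1).
have [l ls E] := track w; exists l => //; move: E; rewrite wE mulgVK.
have -> : cls (t q0 * g) = q0.
  by rewrite -[RHS]cls_t; apply: esym; apply: clsE; rewrite mulKg.
exact: mulgI.
Qed.

End FiniteIndex.

Section Descent.
Local Open Scope group_scope.
Variables (G : groupType) (A B : set G).
Hypotheses (sA : is_subgroup A) (sB : is_subgroup B).
Hypothesis B_conj : forall x y, B x -> A y -> B (x ^ y).
Hypothesis B_comm : forall x y, A x -> A y -> B [~ x, y].

Let eqv x y := B (x^-1 * y).

Lemma eqv_refl x : eqv x x.
Proof. by rewrite /eqv mulVg; exact: subgroup1. Qed.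

Lemma eqv_trans y x z : eqv x y -> eqv y z -> eqv x z.
Proof.
by move=> xy yz; rewrite /eqv -[x^-1 * z](_ : x^-1 * y * (y^-1 * z) = _);
  [exact: (subgroupM sB) | rewrite mulgA mulgK].
Qed.

Lemma eqv_mull x y z : eqv y z -> eqv (x * y) (x * z).
Proof. by rewrite /eqv invgM -mulgA mulKg. Qed.

Lemma eqv_mulr x y z : A z -> eqv x y -> eqv (x * z) (y * z).
Proof. by move=> Az xy; rewrite /eqv invgM -!mulgA (mulgA x^-1); apply: B_conj. Qed.

Lemma eqv_comm x y : A x -> A y -> eqv (x * y) (y * x).
Proof.
move=> Ax Ay; rewrite /eqv invgM -mulgA.
have -> : y^-1 * (x^-1 * (y * x)) = [~ y, x] by rewrite commgEl conjgE.
exact: B_comm.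
Qed.

Lemma subgroupX (K : set G) x n : is_subgroup K -> K x -> K (x ^+ n).
Proof.
move=> sK Kx; elim: n => [|n IH]; first exact: subgroup1.
by rewrite expgS; apply: (subgroupM sK).
Qed.

Lemma subgroup_prodl (K : set G) l : is_subgroup K -> (forall x, x \in l -> K x) -> K (prodl l).
Proof.
move=> sK; elim: l => [|x l IH] lK /=; first exact: subgroup1.
apply: (subgroupM sK); first by apply: lK; rewrite inE eqxx.
by apply: IH => y yl; apply: lK; rewrite inE yl orbT.
Qed.

(** Modulo [B] the elements of [s] commute and have finite order, so that every
    product of them is congruent to an ordered product of bounded powers. *)
Lemma torsion_covers (s : seq G) : (forall x, x \in s -> A x) ->
  (forall x, x \in s -> exists2 d, (0 < d)%N & B (x ^+ d)) ->
  exists R : seq G, forall l, {subset l <= s} -> exists2 r, r \in R & eqv r (prodl l).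
Proof.
elim: s => [|g s IH] sA' tor.
  exists [:: 1] => l ls; exists 1; rewrite ?inE //; case: l ls => [|x l] ls; first exact: eqv_refl.
  by have := ls x; rewrite inE eqxx in_nil => /(_ isT).
have Ag : A g by apply: sA'; rewrite inE eqxx.
have [d d0 gd] := tor g (mem_head _ _).
have As x : x \in s -> A x by move=> xs; apply: sA'; rewrite inE xs orbT.
have [|R HR] := IH As; first by move=> x xs; apply: tor; rewrite inE xs orbT.
exists [seq g ^+ e * r | e <- iota 0 d, r <- R] => l ls.
have [n [l' [l's]]] : exists n l', {subset l' <= s} /\ eqv (g ^+ n * prodl l') (prodl l).
  elim: l ls => [|x l IHl] ls; first by exists 0, [::]; split=> //=; rewrite mulg1; exact: eqv_refl.
  have [|n [l' [l's E]]] := IHl; first by move=> y yl; apply: ls; rewrite inE yl orbT.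
  have := ls x (mem_head _ _); rewrite inE => /orP[/eqP -> | xs].
    by exists n.+1, l'; split=> //=; rewrite expgS -mulgA; apply: eqv_mull.
  exists n, (x :: l'); split=> /=.
    by move=> y; rewrite inE => /orP[/eqP -> // | /l's].
  apply: eqv_trans (eqv_mull x E); rewrite !mulgA; apply: eqv_mulr.
    by apply: subgroup_prodl => // y /l's /As.
  by apply: eqv_comm; [apply: subgroupX | apply: As].
move=> E; have [r rR rE] := HR l' l's.
exists (g ^+ (n %% d) * r).
  by apply: allpairs_f => //; rewrite mem_iota ltn_mod.
apply: eqv_trans E; apply: eqv_trans (eqv_mull _ rE) _; apply: eqv_mulr.
  by apply: subgroup_prodl => // y /l's /As.
rewrite /eqv {2}(divn_eq n d) addnC expgnDr mulKg mulnC expgnA.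
exact: subgroupX.
Qed.

End Descent.

(** * Virtually nilpotent groups whose central commutators are torsion *)

Section VirtuallyNilpotent.
Local Open Scope group_scope.
Variables (G : groupType) (Sigma : finType) (inv : Sigma -> Sigma) (pi : seq Sigma -> G).
Hypothesis pi_gen : is_choice_of_generators inv pi.
Hypothesis comm_torsion : forall x y : G, commute [~ x, y] x -> commute [~ x, y] y ->
  exists2 n, (0 < n)%N & [~ x, y] ^+ n = 1.
Variable H : set G.
Hypotheses (sH : is_subgroup H) (fH : finite_index H).

Notation Z := (upper_central H).

Lemma upper_commute x y : Z 1 x -> H y -> commute x y.
Proof. by move=> [_ h] /h /eqP /commgP. Qed.

(** Moving [~ x, y] past a power of [x] costs an element of the term [i]. *)
Lemma commX_upper i x y n : Z i.+2 x -> H y -> exists2 c, Z i c & [~ x ^+ n, y] = [~ x, y] ^+ n * c.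
Proof.
move=> zx hy; have hx := upper_sub sH zx; have sZ := upper_subgroup sH.
have zxy : Z i.+1 [~ x, y] by case: zx => _; apply.
elim: n => [|n [c zc IH]]; first by exists 1; [exact: subgroup1 | rewrite !expg0 comm1g mulg1].
have zxyn : Z i.+1 ([~ x, y] ^+ n) by apply: subgroupX.
pose e := [~ [~ x, y], x ^+ n].
have ze : Z i e by case: zxy => _; apply; apply: subgroupX.
exists (e ^ ([~ x, y] ^+ n) * c).
  by apply: (subgroupM (sZ i)) => //; apply: (upper_conj sH) => //; apply: upper_sub zxyn.
rewrite expgS commgMl IH expgS; have -> : [~ x, y] ^ (x ^+ n) = [~ x, y] * e by rewrite /e commgEl mulVKg.
by move: [~ x, y] ([~ x, y] ^+ n) (e) => a p e'; rewrite conjgE !mulgA mulgK.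
Qed.

Lemma common_exponent (s : seq G) (K : set G) (f : G -> G) : is_subgroup K ->
  (forall y, y \in s -> exists2 d, (0 < d)%N & K (f y ^+ d)) ->
  exists2 D, (0 < D)%N & forall y, y \in s -> K (f y ^+ D).
Proof.
move=> sK; elim: s => [|y s IH] h; first by exists 1%N.
have [|D D0 hD] := IH; first by move=> z zs; apply: h; rewrite inE zs orbT.
have [d d0 hd] := h y (mem_head _ _).
exists (d * D)%N; first by rewrite muln_gt0 d0.
move=> z; rewrite inE => /orP[/eqP -> | /hD hz].
  by rewrite expgnA; apply: subgroupX.
by rewrite mulnC expgnA; apply: subgroupX.
Qed.

(** By finite generation one exponent works for all [y], and [commX_upper] moves it
    from the commutators to [x]. *)
Lemma upper_torsion_step i x : Z i.+2 x ->
  (forall y, H y -> exists2 d, (0 < d)%N & Z i ([~ x, y] ^+ d)) ->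
  exists2 d, (0 < d)%N & Z i.+1 (x ^+ d).
Proof.
move=> zx tor; have sZ := upper_subgroup sH; have hx := upper_sub sH zx.
have [s [sHs sgen]] := schreier pi_gen sH fH.
have [|D D0 hD] := @common_exponent s (Z i) (fun y => [~ x, y]) (sZ i).
  by move=> y /sHs /tor.
exists D => //; split=> [|_ /sgen [l ls ->]]; first exact: subgroupX.
elim: l ls => [|y l IHl] ls; first by rewrite commg1; exact: subgroup1.
have hy : H y by apply: sHs; apply: ls; rewrite mem_head.
have ls' : {subset l <= s} by move=> z zl; apply: ls; rewrite inE zl orbT.
rewrite [prodl _]/(y * prodl l) commgMr; apply: (subgroupM (sZ i)); first exact: IHl.
apply: (upper_conj sH); last by apply: subgroup_prodl => // z /ls' /sHs.
have [c zc ->] := commX_upper D zx hy.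
by apply: (subgroupM (sZ i)) zc; apply: hD; apply: ls; rewrite mem_head.
Qed.

(** The torsion hypothesis on commutators starts the induction: for [x] in the second
    term, the commutator of [x] and [y] is central in [H]. *)
Lemma upper_torsion i x : Z i.+2 x -> exists2 d, (0 < d)%N & Z i.+1 (x ^+ d).
Proof.
elim: i x => [|i IH] x zx; apply: upper_torsion_step (zx) _ => y hy.
  have zxy : Z 1 [~ x, y] by case: zx => _; apply.
  have hx := upper_sub sH zx.
  by have [||d d0 dE] := comm_torsion (x := x) (y := y); [exact: upper_commute zxy _ ..| exists d].
by apply: IH; case: zx => _; apply.
Qed.

(** A term of finite index is finitely generated, and by [upper_torsion] its quotient
    by the next one is abelian, finitely generated and torsion, hence finite. *)
Lemma upper_descent i : finite_index (Z i.+2) -> finite_index (Z i.+1).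
Proof.
have sZ := upper_subgroup sH; move=> fZ; have [s [sZs sgen]] := schreier pi_gen (sZ _) fZ.
have [R HR] := (finite_indexP (sZ _)).1 fZ.
apply/(finite_indexP (sZ _)).
have [|||R' HR'] := @torsion_covers _ (Z i.+2) (Z i.+1) (sZ _) (sZ _) _ _ s sZs.
- by move=> x y zx /(upper_sub sH); apply: (upper_conj sH).
- by move=> x y [_ zx] /(upper_sub sH); apply: zx.
- by move=> x /sZs /upper_torsion.
apply: (@covers_trans _ R R' _ _ _ HR) => g /sgen [l ls ->].
exact: HR'.
Qed.

Lemma virtually_abelian_of_nilpotent : nilpotent_subgroup H -> virtually_abelian G.
Proof.
move=> /(upper_exhausts sH)[n Hn]; exists (Z 1); split; first exact: upper_subgroup.
  have : finite_index (Z n.+1).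
    rewrite (_ : Z n.+1 = H) //; apply/seteqP; split=> x; [exact: upper_sub | exact: Hn].
  by elim: n {Hn} => // n IH /upper_descent.
by move=> x y zx /(upper_sub sH); apply: upper_commute.
Qed.

End VirtuallyNilpotent.

(** * Virtually nilpotent groups with multiple context-free word problem *)

Theorem corollary1 (G : groupType) (Gfg : finitely_generated G)
    (Gvn : virtually_nilpotent G)
    (Sigma : finType) (inv : Sigma -> Sigma) (pi : seq Sigma -> G)
    (pi_gen : is_choice_of_generators inv pi) :
  multiple_context_free (word_problem pi) <-> virtually_abelian G.
Proof.
split=> [mcf | va]; last exact: virtually_abelian_mcf pi_gen va.
have [H [sH fH nH]] := Gvn.
apply: (virtually_abelian_of_nilpotent pi_gen _ sH fH nH) => x y zx zy.
exact: (mcf_commutator_torsion pi_gen mcf zx zy).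
Qed.
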